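(* Let $r\ge3$ and $s\ge r+5$, and let $Y^r_s$ be the blowup of $\mathbb{P}^r$ at $s$ general points. Then the orbit under the Weyl group $W$ of (the class $h-e_1-e_2$ of) the proper transform of a line through two of the points is infinite. Hence there are infinitely many $(-1)$-Weyl lines and infinitely many numerical $(-1)$-classes in $Y^r_s$.
   Context: Work over $\mathbb{C}$. $A^{r-1}(Y^r_s)$ has basis $h$ (pullback of a general line) and $e_1,\dots,e_s$ ($e_i$ the class of a line in the exceptional divisor $E_i$). For an $(r+1)$-subset $I\subset\{1,\dots,s\}$ let $\phi_I(dh-\sum m_ie_i)=(d+(r-1)t)h-\sum_{i\in I}(m_i+t)e_i-\sum_{i\notin I}m_ie_i$ with $t=d-\sum_{i\in I}m_i$; this is the action of the standard Cremona transformation based at the points indexed by $I$. $W$ is generated by all $\phi_I$ and the permutations of the indices. A $(-1)$-Weyl line is a curve that is the Cremona image (under $W$) of the proper transform of a line through two of the $s$ points. A numerical $(-1)$-class is a class $c\in A^{r-1}(Y^r_s)$ with $(K_Y\cdot c)=-2+(r-1)=r-3$, where $(K_Y\cdot(dh-\sum m_ie_i))=-(r+1)d+(r-1)\sum m_i$. *)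

(* Defs.v *)
(* Mathematical Components (with the realType of MathComp-Analysis). *)
From HB Require Import structures.
From mathcomp Require Import all_boot all_order all_algebra all_fingroup.
From mathcomp Require Import boolp classical_sets cardinality reals.
From mathcomp Require Import complex.
From mathcomp Require mpoly.

Set Implicit Arguments.
Unset Strict Implicit.
Unset Printing Implicit Defensive.

Import GRing.Theory Num.Theory.
Local Open Scope classical_set_scope.
Local Open Scope ring_scope.

(* The pair (d, m) stands for the class d h - \sum_i m_i e_i in
   A^{r-1}(Y^r_s): note the sign in front of the m_i. *)
Definition curve_class (s : nat) : Type := (int * {ffun 'I_s -> int})%type.

Definition line_class (s : nat) (i j : 'I_s) : curve_class s :=
  (1, [ffun k => ((k == i) || (k == j))%:Z]).

Definition cremona_class (r s : nat) (I : {set 'I_s}) (c : curve_class s) :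
    curve_class s :=
  let t := c.1 - \sum_(i in I) c.2 i in
  (c.1 + (r%:Z - 1) * t, [ffun i => if i \in I then c.2 i + t else c.2 i]).

Definition perm_class (s : nat) (sigma : {perm 'I_s}) (c : curve_class s) :
    curve_class s :=
  (c.1, [ffun i => c.2 (sigma i)]).

Inductive weyl_group (r s : nat) : (curve_class s -> curve_class s) -> Prop :=
| weyl_cremona (I : {set 'I_s}) :
    #|I| = r.+1 -> weyl_group r (cremona_class r I)
| weyl_perm (sigma : {perm 'I_s}) : weyl_group r (perm_class sigma)
| weyl_id : weyl_group r id
| weyl_comp (v w : curve_class s -> curve_class s) :
    weyl_group r v -> weyl_group r w -> weyl_group r (v \o w)
| weyl_inv (v w : curve_class s -> curve_class s) :
    weyl_group r v -> cancel v w -> cancel w v -> weyl_group r w.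

Definition weyl_orbit (r s : nat) (c : curve_class s) : set (curve_class s) :=
  [set c' | exists2 w, weyl_group r w & c' = w c].

Definition canonical_degree (r s : nat) (c : curve_class s) : int :=
  - (r%:Z + 1) * c.1 + (r%:Z - 1) * \sum_i c.2 i.

Definition numerical_m1_class (r s : nat) (c : curve_class s) : Prop :=
  canonical_degree r c = r%:Z - 3.

(* [rep t M] says that the matrix M is a system of coordinates of the point t
   (projective space: a spanning vector, and similarly for the other varieties
   below).  In each use the matrices that represent some point form a Zariski
   open subset of a cone and [rep] is the graph of an open surjection, so that
   the sets described here are exactly the Zariski closed ones.  As all
   coordinates of t are tested, no homogeneity of the equations is needed. *)
Definition zariski_closed (K : fieldType) (m n : nat) (T : Type)
    (rep : T -> 'M[K]_(m, n) -> Prop) (Z : set T) : Prop :=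
  exists E : set (mpoly.mpoly (m * n) K), forall t : T,
    Z t <-> (forall M, rep t M -> forall F, E F ->
               mpoly.meval (fun k => mxvec M ord0 k) F = 0).

Definition zariski_closure (K : fieldType) (m n : nat) (T : Type)
    (rep : T -> 'M[K]_(m, n) -> Prop) (A : set T) : set T :=
  [set t | forall Z, zariski_closed rep Z -> A `<=` Z -> Z t].

Definition proj_space (K : fieldType) (r : nat) : Type :=
  {x : {vspace 'rV[K]_r.+1} | \dim x == 1%N}.

Definition proj_rep (K : fieldType) (r : nat) (x : proj_space K r)
    (u : 'rV[K]_r.+1) : Prop :=
  val x = <[u]>%VS.

Definition config (K : fieldType) (r s : nat) : Type :=
  'I_s -> proj_space K r.

Definition config_rep (K : fieldType) (r s : nat) (p : config K r s)
    (M : 'M[K]_(s, r.+1)) : Prop :=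
  forall i, proj_rep (p i) (row i M).

(* Since W is infinite, "general" has to be read as "very general": outside a
   countable union of proper Zariski closed subsets of (P^r)^s. *)
Definition very_general (K : fieldType) (r s : nat)
    (P : config K r s -> Prop) : Prop :=
  exists2 Z : nat -> set (config K r s),
    (forall k, zariski_closed (@config_rep K r s) (Z k) /\ Z k <> setT) &
    (forall p, (forall k, ~ Z k p) -> P p).

(* The blowup of P^r at distinct points p_1, ..., p_s, as the incidence variety
   of the (x, l_1, ..., l_s) where l_i is a line through p_i and x. *)
Definition blowup (K : fieldType) (r s : nat) (p : config K r s) : Type :=
  {y : proj_space K r * {ffun 'I_s -> {vspace 'rV[K]_r.+1}} |
     [forall i, [&& \dim (y.2 i) == 2%N, (val y.1 <= y.2 i)%VS
                  & (val (p i) <= y.2 i)%VS]]}.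

Definition blowdown (K : fieldType) (r s : nat) (p : config K r s)
    (y : blowup p) : proj_space K r :=
  (val y).1.

(* Row 0 spans the point x; row i + 1 spans the line l_i together with p_i. *)
Definition blowup_rep (K : fieldType) (r s : nat) (p : config K r s)
    (y : blowup p) (M : 'M[K]_(s.+1, r.+1)) : Prop :=
  proj_rep (blowdown y) (row ord0 M) /\
  forall i, (val y).2 i = (val (p i) + <[row (lift ord0 i) M]>)%VS.

Definition proper_transform (K : fieldType) (r s : nat) (p : config K r s)
    (C : set (proj_space K r)) : set (blowup p) :=
  zariski_closure (@blowup_rep K r s p)
    [set y | C (blowdown y) /\ forall i, blowdown y <> p i].

Definition line_through (K : fieldType) (r : nat) (x y : proj_space K r) :
    set (proj_space K r) :=
  [set z | (val z <= val x + val y)%VS].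

(* When #|I| = r + 1, the vectors f_i (i in I) form a basis. *)
Definition is_frame (K : fieldType) (r s : nat) (I : {set 'I_s})
    (p : config K r s) (f : 'I_s -> 'rV[K]_r.+1) : Prop :=
  (forall i, i \in I -> proj_rep (p i) (f i)) /\
  (\sum_(i in I) <[f i]>)%VS = fullv.

(* The graph, on the complement of the coordinate hyperplanes, of the standard
   Cremona transformation based at the points <[f_i]>, with the frame g in the
   target: (a_i) |-> (1 / a_i). *)
Definition cremona (K : fieldType) (r s : nat) (I : {set 'I_s})
    (f g : 'I_s -> 'rV[K]_r.+1) (x y : proj_space K r) : Prop :=
  exists a : 'I_s -> K,
    [/\ forall i, i \in I -> a i != 0,
        proj_rep x (\sum_(i in I) a i *: f i)
      & proj_rep y (\sum_(i in I) (a i)^-1 *: g i)].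

(* The standard Cremona transformation based at the q_i (i in I) induces a
   birational map, an isomorphism in codimension 1, from the blowup at q to the
   blowup at p, which acts on classes of curves by cremona_class r I. *)
Definition cremona_between (K : fieldType) (r s : nat) (I : {set 'I_s})
    (q p : config K r s) (f g : 'I_s -> 'rV[K]_r.+1) : Prop :=
  [/\ #|I| = r.+1, is_frame I q f, is_frame I p g
    & forall j, j \notin I -> cremona I f g (q j) (p j)].

(* [weyl_curve p C]: C is a curve in P^r whose proper transform in the blowup
   at p is the image, under a sequence of Cremona transformations and
   permutations, of the proper transform of a line through two of the points
   of some configuration.  At each Cremona step the curve must meet the open
   set on which the transformation is an isomorphism. *)
Inductive weyl_curve (K : fieldType) (r s : nat) :
    config K r s -> set (proj_space K r) -> Prop :=
| weyl_curve_line (p : config K r s) (i j : 'I_s) :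
    p i <> p j -> weyl_curve p (line_through (p i) (p j))
| weyl_curve_perm (sigma : {perm 'I_s}) (p : config K r s)
    (C : set (proj_space K r)) :
    weyl_curve p C -> weyl_curve (p \o sigma) C
| weyl_curve_cremona (I : {set 'I_s}) (q p : config K r s)
    (f g : 'I_s -> 'rV[K]_r.+1) (C : set (proj_space K r)) :
    weyl_curve q C ->
    cremona_between I q p f g ->
    (exists x y, C x /\ cremona I f g x y) ->
    weyl_curve p (zariski_closure (@proj_rep K r)
                    [set y | exists2 x, C x & cremona I f g x y]).

Definition weyl_line (K : fieldType) (r s : nat) (p : config K r s)
    (D : set (blowup p)) : Prop :=
  exists2 C, weyl_curve p C & D = proper_transform (p := p) C.

(* Main.v *)
(**
The roots attached to two (r+1)-sets I, J with |I :&: J| = r - 3 have product 2,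
so the two Cremona reflections generate an infinite group; on the class of a line
through two points of I \ J, applying J and I in turn raises the degree by r - 1
at each step.

For the curves, transport a point configuration p backwards through Cremona
transformations based alternately at I and J, and push the line through two
points of I of the configuration obtained after l steps (l even) forward to p.
The curves so obtained are distinct for different l as soon as all the steps are
defined at a general point of the line: the last transformation, based at I,
moves that point off the coordinate hyperplanes of I, hence off a line through
two points of I.  That all steps are defined is a polynomial condition on p for
each l, so a single configuration with this property suffices.

Take the points on a cuspidal curve of degree r + 1 in P^r, on which hyperplane
sections are given by the sum of the parameters.  A Cremona transformation based
at points of the curve maps it to a curve of the same kind and translates the
parameters of its base points.  The secants whose end points have a fixed
parameter sum sweep out a scroll, and this scroll is mapped to another such
scroll.  If an image of the line fell into a coordinate hyperplane H, it would
lie in the intersection of H with the scroll, a rational curve through the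
residual point of H on the cuspidal curve.  Then that point would also come from
the line, but the line meets the cuspidal curve only in the two chosen points.
*)

Require Import Defs.
From mathcomp Require Import all_boot all_order all_algebra all_fingroup.
From mathcomp Require Import boolp classical_sets cardinality reals.
From mathcomp Require Import complex.
From mathcomp Require mpoly.
Import (canonicals) mpoly.
From mathcomp Require Import ring zify.

Set Implicit Arguments.
Unset Strict Implicit.
Unset Printing Implicit Defensive.

Import Order.TTheory GRing.Theory Num.Theory.
Local Open Scope ring_scope.

(** * The orbit of the class of a line *)

Lemma infinite_range (T : Type) (f : nat -> T) (A : set T) :
  injective f -> (forall k, A (f k)) -> infinite_set A.
Proof.
move=> f_inj fA finA; apply: infinite_nat.
have fin_range : finite_set (range f).
  by apply: sub_finite_set finA => _ [k _ <-].
rewrite -(eq_finite_set (inj_card_eq (f := f) _)) // => k k' _ _; exact: f_inj.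
Qed.

Lemma exists_subset_card (T : finType) (A : {set T}) (k : nat) :
  (k <= #|A|)%N -> exists2 B : {set T}, B \subset A & #|B| = k.
Proof.
move=> kA; exists [set x in take k (enum A)].
  by apply/fintype.subsetP=> x; rewrite inE => /mem_take; rewrite mem_enum.
rewrite cardsE (card_uniqP _) ?take_uniq ?enum_uniq //.
by rewrite size_takel // -cardE.
Qed.

(** The increment [t] of [cremona_class]. Geometrically it is the intersection number of the class
    with the root H - sum of the E_i over [X]. *)
Definition excess (s : nat) (X : {set 'I_s}) (c : curve_class s) : int :=
  c.1 - \sum_(i in X) c.2 i.

(** The coefficient is the product of the roots of [X] and [Y]: it is -2 for [X = Y] of size r + 1,
    and 2 for sets that share r - 3 indices. *)
Lemma excess_cremona (r s : nat) (X Y : {set 'I_s}) (c : curve_class s) :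
  excess X (cremona_class r Y c) =
  excess X c + (r%:Z - 1 - #|X :&: Y|%:Z) * excess Y c.
Proof.
rewrite /excess /cremona_class /=; set t := c.1 - \sum_(i in Y) c.2 i.
have -> : \sum_(i in X) [ffun i => if i \in Y then c.2 i + t else c.2 i] i =
          \sum_(i in X) c.2 i + #|X :&: Y|%:Z * t.
  transitivity (\sum_(i in X) (c.2 i + (if i \in Y then t else 0))).
    by apply: eq_bigr => i _; rewrite ffunE; case: ifP; rewrite ?addr0.
  rewrite big_split /= -big_mkcondr /=; congr (_ + _).
  rewrite (eq_bigl (mem (X :&: Y))) => [|i]; last by rewrite /= inE.
  by rewrite sumr_const -mulr_natl natz.
ring.
Qed.

Section ParabolicOrbit.
Variables (r s : nat) (I J : {set 'I_s}).
Hypotheses (r3 : (3 <= r)%N) (cI : #|I| = r.+1) (cJ : #|J| = r.+1).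
Hypothesis cIJ : #|I :&: J| = (r - 3)%N.

(* The roots of [I] and [J] have product 2, so [w] is parabolic: the two
   excesses are periodic along its orbits while the degree grows linearly. *)
Let w : curve_class s -> curve_class s := cremona_class r I \o cremona_class r J.

(** The reflection at [J] turns the pair of excesses (-1, 1) into (1, -1), and the one at [I] turns
    it back. Each is applied with [t = 1], so each adds r - 1 to the degree. *)
Lemma parabolic_step (c : curve_class s) :
  excess I c = -1 -> excess J c = 1 ->
  [/\ excess I (w c) = -1, excess J (w c) = 1 &
      (w c).1 = c.1 + 2 * (r%:Z - 1)].
Proof.
move=> eI eJ.
have eI1 : excess I (cremona_class r J c) = 1.
  by rewrite excess_cremona cIJ eI eJ; lia.
have eJ1 : excess J (cremona_class r J c) = -1.
  by rewrite excess_cremona finset.setIid cJ eJ; lia.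
split; first by rewrite excess_cremona finset.setIid cI eI1; lia.
  by rewrite excess_cremona finset.setIC cIJ eI1 eJ1; lia.
rewrite /w /cremona_class /= -/(excess J c) eJ.
have := eI1; rewrite /excess /cremona_class /= -/(excess J c) eJ.
by move=> ->; ring.
Qed.

Lemma parabolic_orbit_infinite (c : curve_class s) :
  excess I c = -1 -> excess J c = 1 -> infinite_set (weyl_orbit r c).
Proof.
move=> eI eJ; have it k : [/\ excess I (iter k w c) = -1,
    excess J (iter k w c) = 1 & (iter k w c).1 = c.1 + 2 * (r%:Z - 1) * k%:Z].
  elim: k => [|k [IHI IHJ IH1]]; first by split=> //=; ring.
  have [-> -> /= ->] := parabolic_step IHI IHJ.
  by rewrite IH1; split=> //; lia.
apply: (@infinite_range _ (fun k => iter k w c)) => [k k' /(congr1 fst)|k].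
  have [_ _ ->] := it k; have [_ _ ->] := it k'.
  by move=> /addrI /mulfI E; apply/eqP; rewrite -eqz_nat; apply/eqP/E; lia.
exists (iter k w) => //; elim: k => [|k IH]; first exact: weyl_id.
have -> : iter k.+1 w = w \o iter k w by [].
apply: weyl_comp IH; apply: weyl_comp; exact: weyl_cremona.
Qed.

End ParabolicOrbit.

Lemma line_orbit_infinite (r s : nat) (i j : 'I_s) :
  (3 <= r)%N -> (r + 5 <= s)%N -> i != j ->
  infinite_set (weyl_orbit r (line_class i j)).
Proof.
move=> r3 rs ij.
have c2 : #|[set i; j]| = 2%N by rewrite cards2 ij.
have [J Jsub cJ] : exists2 J : {set 'I_s}, J \subset ~: [set i; j] & #|J| = r.+1.
  by apply: exists_subset_card; rewrite cardsCs finset.setCK c2 card_ord; lia.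
have [U Usub cU] : exists2 U : {set 'I_s}, U \subset J & #|U| = (r - 3)%N.
  by apply: exists_subset_card; rewrite cJ; lia.
have dJ : [disjoint [set i; j] & J].
  by rewrite disjoint_sym finset.disjoints_subset.
have [V Vsub cV] : exists2 V : {set 'I_s},
    V \subset ~: ([set i; j] :|: J) & #|V| = 2%N.
  apply: exists_subset_card; rewrite cardsCs finset.setCK cardsU.
  by rewrite (disjoint_setI0 dJ) cards0 c2 cJ card_ord; lia.
have VN x : x \in V -> (x \notin [set i; j]) && (x \notin J).
  by move/(fintype.subsetP Vsub); rewrite !inE negb_or.
(* [I] contains i and j while [J] avoids both, so the excesses of the line class are 1 - 2 = -1 and
   1. The construction uses 2 + (r + 1) + 2 = r + 5 indices. *)
pose I := [set i; j] :|: U :|: V.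
have IJ : I :&: J = U.
  apply/finset.setP=> x; rewrite 2!inE [x \in _ :|: U]inE.
  have [xJ|xJ] := boolP (x \in J); last first.
    by rewrite andbF; apply/esym/negP => /(fintype.subsetP Usub); rewrite (negPf xJ).
  have -> : x \in [set i; j] = false.
    by apply/negP => xij; have := disjointFr dJ xij; rewrite xJ.
  rewrite andbT /=; case: (boolP (x \in V)) => [/VN|_]; last by rewrite orbF.
  by rewrite xJ andbF.
have cI : #|I| = r.+1.
  have d1 : [set i; j] :&: U = finset.set0.
    by apply/disjoint_setI0; apply: disjointWr dJ.
  have d2 : ([set i; j] :|: U) :&: V = finset.set0.
    apply/finset.setP=> x; rewrite finset.in_set0 inE; apply/negP=> /andP[+ /VN/andP[xij xJ]].
    by rewrite inE (negPf xij) /= => /(fintype.subsetP Usub); rewrite (negPf xJ).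
  by rewrite cardsU d2 cards0 cardsU d1 cards0 c2 cU cV; lia.
have sumE (X : {set 'I_s}) : \sum_(k in X) (line_class i j).2 k =
    #|X :&: [set i; j]|%:Z.
  rewrite -sum1_card -natz natr_sum big_mkcond [RHS]big_mkcond /=.
  apply: eq_bigr => k _; rewrite ffunE !inE.
  by case: (k \in X) => //=; case: (_ || _).
apply: (parabolic_orbit_infinite r3 cI cJ); rewrite ?IJ // /excess sumE.
  by rewrite (finset.setIidPr _) ?c2 // /I -finset.setUA finset.subsetUl.
by rewrite finset.setIC (disjoint_setI0 dJ) cards0.
Qed.

(** The canonical degree sees only the degree and the sum of the multiplicities. Degree 1 with
    multiplicities 1 + k, 1 - k, 0, ... has the same values as a line through two points. *)
Lemma numerical_m1_infinite (r s : nat) : (2 <= s)%N ->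
  infinite_set [set c : curve_class s | numerical_m1_class r c]%classic.
Proof.
case: s => [|[|s]] // _.
pose m (k : nat) : {ffun 'I_s.+2 -> int} :=
  [ffun i => if i == ord0 then 1 + k%:Z else if i == lift ord0 ord0 then 1 - k%:Z
             else 0].
apply: (@infinite_range _ (fun k => (1, m k))) => [k k' [] /ffunP|k].
  by move=> /(_ ord0); rewrite !ffunE eqxx; lia.
rewrite /= /numerical_m1_class /canonical_degree /= big_ord_recl big_ord_recl.
rewrite !ffunE /= big1 => [|i _]; last by rewrite ffunE.
ring.
Qed.

(** * Polynomial functions *)

Section FunctionAlgebra.
Variables (K : comNzRingType) (T : Type) (P : (T -> K) -> Prop).

(** Kept abstract because the same closure arguments serve polynomials in the entries of a
    configuration matrix and polynomials in the parameter of a moving point. *)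
Definition function_algebra : Prop :=
  [/\ forall c, P (fun=> c),
      forall f g, P f -> P g -> P (fun x => f x + g x)
    & forall f g, P f -> P g -> P (fun x => f x * g x)].

Definition mx_in_algebra (m n : nat) (F : T -> 'M[K]_(m, n)) : Prop :=
  forall i j, P (fun x => F x i j).

Hypothesis algP : function_algebra.

Lemma algebra_cst c : P (fun=> c).
Proof. by case: algP. Qed.

Lemma algebra_add f g : P f -> P g -> P (fun x => f x + g x).
Proof. by case: algP => _ + _; exact. Qed.

Lemma algebra_mul f g : P f -> P g -> P (fun x => f x * g x).
Proof. by case: algP => _ _; exact. Qed.

Lemma algebra_sum I (l : seq I) (Q : pred I) (f : I -> T -> K) :
  (forall i, P (f i)) -> P (fun x => \sum_(i <- l | Q i) f i x).
Proof.
move=> Pf; elim: l => [|i l IH].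
  have -> : (fun x => \sum_(i <- [::] | Q i) f i x) = fun=> 0.
    by apply: funext => x; rewrite big_nil.
  exact: algebra_cst.
have [Qi|Qi] := boolP (Q i).
  have -> : (fun x => \sum_(j <- i :: l | Q j) f j x) =
            fun x => f i x + \sum_(j <- l | Q j) f j x.
    by apply: funext => x; rewrite big_cons Qi.
  exact: algebra_add.
have -> // : (fun x => \sum_(j <- i :: l | Q j) f j x) =
          fun x => \sum_(j <- l | Q j) f j x.
by apply: funext => x; rewrite big_cons (negPf Qi).
Qed.

Lemma algebra_prod I (l : seq I) (Q : pred I) (f : I -> T -> K) :
  (forall i, P (f i)) -> P (fun x => \prod_(i <- l | Q i) f i x).
Proof.
move=> Pf; elim: l => [|i l IH].
  have -> : (fun x => \prod_(i <- [::] | Q i) f i x) = fun=> 1.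
    by apply: funext => x; rewrite big_nil.
  exact: algebra_cst.
have [Qi|Qi] := boolP (Q i).
  have -> : (fun x => \prod_(j <- i :: l | Q j) f j x) =
            fun x => f i x * \prod_(j <- l | Q j) f j x.
    by apply: funext => x; rewrite big_cons Qi.
  exact: algebra_mul.
have -> // : (fun x => \prod_(j <- i :: l | Q j) f j x) =
          fun x => \prod_(j <- l | Q j) f j x.
by apply: funext => x; rewrite big_cons (negPf Qi).
Qed.

Lemma algebra_mulmx m n p (F : T -> 'M_(m, n)) (G : T -> 'M_(n, p)) :
  mx_in_algebra F -> mx_in_algebra G -> mx_in_algebra (fun x => F x *m G x).
Proof.
move=> PF PG i j.
have -> : (fun x => (F x *m G x) i j) = fun x => \sum_k F x i k * G x k j.
  by apply: funext => x; rewrite mxE.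
by apply: algebra_sum => k; apply: algebra_mul.
Qed.

Lemma algebra_det n (F : T -> 'M_n) :
  mx_in_algebra F -> P (fun x => \det (F x)).
Proof.
move=> PF; apply: algebra_sum => sigma.
by apply: algebra_mul; [exact: algebra_cst | exact: algebra_prod].
Qed.

Lemma algebra_adj n (F : T -> 'M_n) :
  mx_in_algebra F -> mx_in_algebra (fun x => \adj (F x)).
Proof.
move=> PF i j.
have -> : (fun x => (\adj (F x)) i j) = fun x => cofactor (F x) j i.
  by apply: funext => x; rewrite mxE.
apply: algebra_mul; first exact: algebra_cst.
apply: algebra_det => a b.
have -> // : (fun x => (row' j (col' i (F x))) a b) =
             fun x => F x (lift j a) (lift i b).
by apply: funext => x; rewrite !mxE.
Qed.

End FunctionAlgebra.

Lemma mx_in_algebra_cst (K : comNzRingType) (T : Type) (P : (T -> K) -> Prop)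
    (m n : nat) (A : 'M[K]_(m, n)) :
  function_algebra P -> mx_in_algebra P (fun=> A).
Proof. by move=> algP i j; exact: algebra_cst. Qed.

Definition mx_polynomial (K : comNzRingType) (m n : nat) (f : 'M[K]_(m, n) -> K) :=
  exists F : mpoly.mpoly (m * n) K,
    forall M, mpoly.meval (fun k => mxvec M ord0 k) F = f M.

Lemma mx_polynomial_algebra (K : comNzRingType) (m n : nat) :
  function_algebra (@mx_polynomial K m n).
Proof.
split=> [c|f g [F fF] [G gG]|f g [F fF] [G gG]].
- by exists (mpoly.mpolyC _ c) => M; rewrite mpoly.mevalC.
- by exists (F + G) => M; rewrite mpoly.mevalD fF gG.
- by exists (F * G) => M; rewrite mpoly.mevalM fF gG.
Qed.

Lemma mx_polynomial_entry (K : comNzRingType) (m n : nat) :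
  mx_in_algebra (@mx_polynomial K m n) id.
Proof.
by move=> i j; exists (mpoly.mpolyX K (mpoly.mnm1 (mxvec_index i j))) => M;
  rewrite mpoly.mevalXU mxvecE.
Qed.

Definition polynomial_fun (K : comNzRingType) (f : K -> K) :=
  exists p : {poly K}, forall x, p.[x] = f x.

Lemma polynomial_fun_algebra (K : comNzRingType) :
  function_algebra (@polynomial_fun K).
Proof.
split=> [c|f g [p fp] [q gq]|f g [p fp] [q gq]].
- by exists c%:P => x; rewrite hornerC.
- by exists (p + q) => x; rewrite hornerD fp gq.
- by exists (p * q) => x; rewrite hornerM fp gq.
Qed.

Lemma polynomial_fun_id (K : comNzRingType) : polynomial_fun (@id K).
Proof. by exists 'X => x; rewrite hornerX. Qed.

(** * Cremona transformations *)

Section CremonaVector.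
Variables (K : fieldType) (n : nat).
Implicit Types (B : 'M[K]_n) (x y : 'rV[K]_n).

Definition proportional x y := exists2 c : K, c != 0 & x = c *: y.

Lemma proportional_sym x y : proportional x y -> proportional y x.
Proof.
case=> c c0 ->; exists c^-1; rewrite ?invr_eq0 //.
by rewrite scalerA mulVf ?scale1r.
Qed.

Lemma proportional_trans x y z :
  proportional x y -> proportional y z -> proportional x z.
Proof.
by case=> c c0 -> [d d0 ->]; exists (c * d); rewrite ?mulf_neq0 ?scalerA.
Qed.

Lemma proportionalZ (c : K) x : c != 0 -> proportional (c *: x) x.
Proof. by move=> c0; exists c. Qed.

(* Up to the factor [\det B], the coordinates of [x] in the rows of [B]; they
   are polynomial in both [B] and [x]. *)
Definition frame_coord B x : 'rV[K]_n := x *m \adj B.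

(** The map that inverts the coordinates, with denominators cleared by the product of all
    coordinates. Source and target use the same frame [B]. *)
Definition cremona_vec B x : 'rV[K]_n :=
  (\row_i \prod_(l | l != i) frame_coord B x 0 l) *m B.

Lemma frame_coordZ B (c : K) x : frame_coord B (c *: x) = c *: frame_coord B x.
Proof. by rewrite /frame_coord scalemxAl. Qed.

Lemma frame_coordM B (a : 'rV_n) : frame_coord B (a *m B) = \det B *: a.
Proof. by rewrite /frame_coord -mulmxA mul_mx_adj mul_mx_scalar. Qed.

Lemma frame_coordK B x : frame_coord B x *m B = \det B *: x.
Proof. by rewrite /frame_coord -mulmxA mul_adj_mx mul_mx_scalar. Qed.

Lemma frame_coord_row B (i j : 'I_n) :
  frame_coord B (row i B) 0 j = \det B * (i == j)%:R.
Proof. by rewrite rowE frame_coordM !mxE eqxx /= eq_sym. Qed.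

Lemma cremona_vecZ B (c : K) x :
  cremona_vec B (c *: x) = c ^+ n.-1 *: cremona_vec B x.
Proof.
rewrite /cremona_vec scalemxAl; congr (_ *m _); apply/rowP=> i; rewrite !mxE.
under eq_bigr => l _ do rewrite frame_coordZ mxE.
rewrite big_split /= prodr_const; congr (_ ^+ _ * _).
by rewrite cardC1 card_ord.
Qed.

Lemma cremona_vec_proportional B x y :
  proportional x y -> proportional (cremona_vec B x) (cremona_vec B y).
Proof. by case=> c c0 ->; rewrite cremona_vecZ; apply: proportionalZ; rewrite expf_neq0. Qed.

Variable B : 'M[K]_n.
Hypothesis B0 : \det B != 0.

Lemma cremona_vecE (a : 'rV_n) : (forall i, a 0 i != 0) ->
  proportional (cremona_vec B (a *m B)) ((\row_i (a 0 i)^-1) *m B).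
Proof.
move=> a0; exists ((\prod_l (\det B * a 0 l)) / \det B).
  rewrite mulf_neq0 ?invr_eq0 //.
  by apply/prodf_neq0 => l _; rewrite mulf_neq0.
rewrite /cremona_vec frame_coordM scalemxAl; congr (_ *m _).
apply/rowP=> i; rewrite !mxE [in RHS](bigD1 i) //=.
under eq_bigr => l _ do rewrite mxE.
by field; rewrite B0 a0.
Qed.

Lemma cremona_vec_coord x :
  (forall i, frame_coord B x 0 i != 0) -> forall i, frame_coord B (cremona_vec B x) 0 i != 0.
Proof.
move=> x0 i; rewrite /cremona_vec frame_coordM !mxE mulf_neq0 //.
by apply/prodf_neq0.
Qed.

Lemma cremona_vecK x : (forall i, frame_coord B x 0 i != 0) ->
  proportional (cremona_vec B (cremona_vec B x)) x.
Proof.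
move=> x0; set a := frame_coord B x in x0.
have xa : proportional x (a *m B).
  by apply: proportional_sym; rewrite frame_coordK; apply: proportionalZ.
apply: (proportional_trans _ (proportional_sym xa)).
have h1 := proportional_trans (cremona_vec_proportional B xa) (cremona_vecE x0).
apply: (proportional_trans (cremona_vec_proportional B h1)).
have ai0 i : (\row_i (a 0 i)^-1) 0 i != 0 by rewrite mxE invr_eq0.
have := cremona_vecE ai0; set b := \row__ _; set b' := \row__ _.
suff -> : b' = a by [].
by apply/rowP=> i; rewrite !mxE invrK.
Qed.

End CremonaVector.

(** * Configurations carried through a sequence of Cremona transformations *)

Section Levels.
Variables (K : fieldType) (r s : nat).
Implicit Types (phi : 'I_r.+1 -> 'I_s) (M : 'M[K]_(s, r.+1)).

Definition frame phi M : 'M[K]_r.+1 := rowsub phi M.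

(** The base points stay where they are and serve as the frame of the target; only the other points
    are moved. *)
Definition cremona_step phi M : 'M[K]_(s, r.+1) :=
  \matrix_(i < s) (if i \in codom phi then row i M
                   else cremona_vec (frame phi M) (row i M)).

Definition framed phi M : Prop :=
  \det (frame phi M) != 0 /\
  forall i, i \notin codom phi -> forall k, frame_coord (frame phi M) (row i M) 0 k != 0.

Lemma row_frame phi M k : row k (frame phi M) = row (phi k) M.
Proof. by rewrite /frame row_rowsub. Qed.

Lemma row_cremona_step phi M i : row i (cremona_step phi M) =
  if i \in codom phi then row i M else cremona_vec (frame phi M) (row i M).
Proof. by rewrite rowK. Qed.

Lemma row_cremona_step_frame phi M k :
  row (phi k) (cremona_step phi M) = row (phi k) M.
Proof. by rewrite row_cremona_step codom_f. Qed.

Lemma framed_row_neq0 phi M i : framed phi M -> row i M != 0.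
Proof.
move=> [B0 coordN0]; apply/eqP=> Mi0.
have Z k : frame_coord (frame phi M) (row i M) 0 k = 0.
  by rewrite Mi0 /frame_coord mul0mx mxE.
have [/codomP[k ik]|iN] := boolP (i \in codom phi); last first.
  by have := coordN0 i iN ord0; rewrite Z eqxx.
by have := frame_coord_row (frame phi M) k k;
  rewrite row_frame -ik Z eqxx mulr1 => /esym/eqP; rewrite (negPf B0).
Qed.

Lemma frame_coord_line phi M (k0 k1 k : 'I_r.+1) (c0 c1 : K) :
  frame_coord (frame phi M) (c0 *: row (phi k0) M + c1 *: row (phi k1) M) 0 k =
  \det (frame phi M) * (c0 * (k0 == k)%:R + c1 * (k1 == k)%:R).
Proof.
have coordE k' : (row (phi k') M *m \adj (frame phi M)) 0 k =
    \det (frame phi M) * (k' == k)%:R by rewrite -row_frame; exact: frame_coord_row.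
by rewrite /frame_coord mulmxDl -!scalemxAl mxE mxE [X in _ + X]mxE !coordE; ring.
Qed.

Variable (fr : nat -> 'I_r.+1 -> 'I_s).

Fixpoint level M (j : nat) : 'M[K]_(s, r.+1) :=
  if j is j'.+1 then cremona_step (fr j') (level M j') else M.

Definition level_frame M j : 'M[K]_r.+1 := frame (fr j) (level M j).

(** Maps a vector of level j to level j + k. As a step keeps the rows of its frame, the same
    [cremona_vec] serves for climbing here and for going down in [descend]. *)
Fixpoint ascend M (j k : nat) (u : 'rV[K]_r.+1) : 'rV[K]_r.+1 :=
  if k is k'.+1 then ascend M j.+1 k' (cremona_vec (level_frame M j) u) else u.

(* The image in level [l - k] of the point [w] of the line through the points
   [a] and [b] of level [l]. *)
Fixpoint descend (a b : 'I_s) M (w : K) (l k : nat) : 'rV[K]_r.+1 :=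
  if k is k'.+1 then
    cremona_vec (level_frame M (l - k)) (descend a b M w l k')
  else row a (level M l) + w *: row b (level M l).

Definition descends (a b : 'I_s) M (w : K) (l k : nat) : Prop :=
  forall k', (k' < k)%N -> forall i,
    frame_coord (level_frame M (l - k'.+1)) (descend a b M w l k') 0 i != 0.

Lemma ascend_proportional M j k u v :
  proportional u v -> proportional (ascend M j k u) (ascend M j k v).
Proof.
elim: k j u v => [|k IH] j u v uv //=.
by apply: IH; apply: cremona_vec_proportional.
Qed.

(** Off the coordinate hyperplanes each step is an involution up to a scalar, so climbing undoes the
    descent step by step. *)
Lemma ascend_descend a b M w l k j : (j + k <= l)%N ->
  (forall i, (i < l)%N -> framed (fr i) (level M i)) ->
  descends a b M w l (j + k) ->
  proportional (ascend M (l - (j + k)) k (descend a b M w l (j + k)))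
               (descend a b M w l j).
Proof.
move=> jkl frM; elim: k jkl => [|k IH] jkl dM.
  by rewrite addn0; exists 1; rewrite ?oner_eq0 ?scale1r.
rewrite addnS in jkl dM *; rewrite [descend _ _ _ _ _ _.+1]/= /ascend -/ascend.
have -> : (l - (j + k).+1).+1 = (l - (j + k))%N by lia.
apply: (proportional_trans _ (IH (ltnW jkl) (fun k' h => dM k' (ltnW h)))).
apply: ascend_proportional.
apply: cremona_vecK => //; last exact: dM.
by apply: (frM _ _).1; lia.
Qed.

Section Algebra.
Variables (T : Type) (P : (T -> K) -> Prop).
Hypothesis algP : function_algebra P.

Lemma algebra_row (F : T -> 'M[K]_(s, r.+1)) i :
  mx_in_algebra P F -> mx_in_algebra P (fun x => row i (F x)).
Proof.
move=> PF a b; have -> // : (fun x => (row i (F x)) a b) = fun x => F x i b.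
by apply: funext => x; rewrite mxE.
Qed.

Lemma algebra_frame phi F :
  mx_in_algebra P F -> mx_in_algebra P (fun x => frame phi (F x)).
Proof.
move=> PF a b; have -> // : (fun x => (frame phi (F x)) a b) = fun x => F x (phi a) b.
by apply: funext => x; rewrite mxE.
Qed.

Lemma algebra_frame_coord (B : T -> 'M[K]_r.+1) F :
  mx_in_algebra P B -> mx_in_algebra P F ->
  mx_in_algebra P (fun x => frame_coord (B x) (F x)).
Proof. by move=> PB PF; apply: algebra_mulmx => //; apply: algebra_adj. Qed.

Lemma algebra_cremona_vec (B : T -> 'M[K]_r.+1) F :
  mx_in_algebra P B -> mx_in_algebra P F ->
  mx_in_algebra P (fun x => cremona_vec (B x) (F x)).
Proof.
move=> PB PF; apply: algebra_mulmx => // i j.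
have -> : (fun x => (\row_i0 \prod_(l | l != i0) frame_coord (B x) (F x) 0 l) i j)
  = fun x => \prod_(l | l != j) frame_coord (B x) (F x) 0 l.
  by apply: funext => x; rewrite mxE.
by apply: algebra_prod => // l; apply: algebra_frame_coord.
Qed.

Lemma algebra_level F j :
  mx_in_algebra P F -> mx_in_algebra P (fun x => level (F x) j).
Proof.
move=> PF; elim: j => [|j IH] //= i k.
have [ic|ic] := boolP (i \in codom (fr j)).
  have -> : (fun x => cremona_step (fr j) (level (F x) j) i k) =
            fun x => (row i (level (F x) j)) 0 k.
    by apply: funext => x; rewrite mxE ic.
  exact: algebra_row.
have -> : (fun x => cremona_step (fr j) (level (F x) j) i k) =
  fun x => (cremona_vec (frame (fr j) (level (F x) j)) (row i (level (F x) j))) 0 k.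
  by apply: funext => x; rewrite mxE (negPf ic).
by apply: algebra_cremona_vec; [exact: algebra_frame | exact: algebra_row].
Qed.

Lemma algebra_level_frame F j :
  mx_in_algebra P F -> mx_in_algebra P (fun x => level_frame (F x) j).
Proof. by move=> PF; apply: algebra_frame; apply: algebra_level. Qed.

Lemma algebra_ascend F j k U :
  mx_in_algebra P F -> mx_in_algebra P U ->
  mx_in_algebra P (fun x => ascend (F x) j k (U x)).
Proof.
move=> PF; elim: k j U => [|k IH] j U PU //=.
by apply: IH; apply: algebra_cremona_vec => //; apply: algebra_level_frame.
Qed.

Lemma algebra_descend a b F W l k :
  mx_in_algebra P F -> P W ->
  mx_in_algebra P (fun x => descend a b (F x) (W x) l k).
Proof.
move=> PF PW; elim: k => [|k IH] /=; last first.
  by apply: algebra_cremona_vec => //; apply: algebra_level_frame.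
move=> i j.
have -> : (fun x => (row a (level (F x) l) + W x *: row b (level (F x) l)) i j) =
  fun x => level (F x) l a j + W x * level (F x) l b j.
  by apply: funext => x; rewrite !mxE.
by apply: algebra_add => //; [|apply: algebra_mul => //]; apply: algebra_level.
Qed.

End Algebra.

End Levels.


(** * Points of projective space and the Cremona relation *)

Section Geometry.
Variables (K : fieldType) (r s : nat).
Implicit Types (phi : 'I_r.+1 -> 'I_s) (M : 'M[K]_(s, r.+1)) (u v : 'rV[K]_r.+1).

Lemma dim_vline1 u : u != 0 -> \dim <[u]>%VS == 1%N.
Proof. by move=> u0; rewrite dim_vline u0. Qed.

Lemma delta_row_neq0 : delta_mx 0 0 != 0 :> 'rV[K]_r.+1.
Proof.
by apply/eqP => /rowP /(_ 0) /eqP; rewrite !mxE !eqxx oner_eq0.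
Qed.

(* Junk value: the zero vector is sent to an arbitrary point. *)
Definition point u : proj_space K r :=
  insubd (exist _ <[delta_mx ord0 ord0]>%VS (dim_vline1 delta_row_neq0) : proj_space K r)
    <[u]>%VS.

Lemma point_rep u : u != 0 -> proj_rep (point u) u.
Proof. by move=> u0; rewrite /proj_rep /point val_insubd dim_vline1. Qed.

Lemma proportional_vline u v : proportional u v -> <[u]>%VS = <[v]>%VS.
Proof.
move=> uv; apply/eqP; rewrite eqEsubv -!memvE; case: uv => c c0 ->.
rewrite memvZ ?memv_line //=; apply/vlineP; exists c^-1.
by rewrite scalerA mulVf ?scale1r.
Qed.

Lemma rep_neq0 (x : proj_space K r) u : proj_rep x u -> u != 0.
Proof.
move=> xu; have := valP x; rewrite /= xu dim_vline.
by case: (u != 0).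
Qed.

Lemma vline_proportional u v : u != 0 -> <[u]>%VS = <[v]>%VS -> proportional u v.
Proof.
move=> u0 uv; have : u \in <[v]>%VS by rewrite -uv memv_line.
case/vlineP=> c uE; exists c => //; apply: contra_neq u0 => c0.
by rewrite uE c0 scale0r.
Qed.

Lemma rep_proportional (x : proj_space K r) u v :
  proj_rep x u -> proj_rep x v -> proportional u v.
Proof.
move=> xu xv; apply: vline_proportional; first exact: rep_neq0 xu.
by rewrite -xu.
Qed.

Lemma rep_transport (x : proj_space K r) u v :
  proj_rep x u -> proportional v u -> proj_rep x v.
Proof. by move=> xu /proportional_vline vu; rewrite /proj_rep vu. Qed.

Lemma point_eq (x : proj_space K r) u : proj_rep x u -> point u = x.
Proof. by move=> xu; apply: val_inj; rewrite /= (point_rep (rep_neq0 xu)). Qed.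

Variable phi : 'I_r.+1 -> 'I_s.
Hypothesis phi_inj : injective phi.

Definition frame_set : {set 'I_s} := [set phi k | k in 'I_r.+1].

Lemma card_frame_set : #|frame_set| = r.+1.
Proof. by rewrite card_imset // card_ord. Qed.

Lemma mem_frame_set i : (i \in frame_set) = (i \in codom phi).
Proof. by apply/imsetP/codomP => [[k _ ->]|[k ->]]; exists k. Qed.

Lemma frame_coefficients (a : 'rV[K]_r.+1) :
  exists alpha : 'I_s -> K, forall k, alpha (phi k) = a 0 k.
Proof.
exists (fun i => if [pick k | phi k == i] is Some k then a 0 k else 0) => k.
by case: pickP => [k' /eqP/phi_inj -> //|/(_ k)]; rewrite eqxx.
Qed.

Lemma sum_frame_set (alpha : 'I_s -> K) M :
  \sum_(i in frame_set) alpha i *: row i M = (\row_k alpha (phi k)) *m frame phi M.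
Proof.
rewrite big_imset /=; last by move=> ? ? _ _; exact: phi_inj.
rewrite mulmx_sum_row; apply: eq_bigr => k _.
by rewrite mxE row_frame.
Qed.

Lemma frame_set_full M : \det (frame phi M) != 0 ->
  (\sum_(i in frame_set) <[row i M]>)%VS = fullv.
Proof.
move=> B0; apply/eqP; rewrite eqEsubv subvf /=; apply/subvP => v _.
have [alpha aE] := frame_coefficients (frame_coord (frame phi M) v).
have -> : v = (\det (frame phi M))^-1 *: \sum_(i in frame_set) alpha i *: row i M.
  rewrite sum_frame_set.
  rewrite (_ : \row__ _ = frame_coord (frame phi M) v).
    by rewrite frame_coordK scalerA mulVf ?scale1r.
  by apply/rowP => k; rewrite mxE aE.
apply: memvZ; apply: memv_suml => i iF.
apply: (subvP (sumv_sup i iF (subvv _))).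
by apply: memvZ; exact: memv_line.
Qed.

Section CremonaRelation.
Variable M : 'M[K]_(s, r.+1).
Hypothesis B0 : \det (frame phi M) != 0.
Let f i := row i M.

(** Source and target share the vectors [f], so inverting the coefficients gives the relation in the
    opposite direction as well. *)
Lemma cremona_relation (x y : proj_space K r) u :
  (forall k, frame_coord (frame phi M) u 0 k != 0) ->
  proj_rep x u -> proj_rep y (cremona_vec (frame phi M) u) ->
  cremona frame_set f f x y /\ cremona frame_set f f y x.
Proof.
set B := frame phi M => u0 xu yu; set a := frame_coord B u in u0.
have ua : proportional (a *m B) u.
  by rewrite frame_coordK; apply: proportionalZ.
have ub : proportional ((\row_k (a 0 k)^-1) *m B) (cremona_vec B u).
  apply: proportional_sym; apply: (proportional_trans _ (cremona_vecE B0 u0)).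
  exact/cremona_vec_proportional/proportional_sym.
have [alpha aE] := frame_coefficients a.
have alpha0 i : i \in frame_set -> alpha i != 0.
  by case/imsetP=> k _ ->; rewrite aE.
have rx : proj_rep x (\sum_(i in frame_set) alpha i *: f i).
  rewrite sum_frame_set (_ : \row__ _ = a).
    exact: rep_transport ua.
  by apply/rowP=> k; rewrite mxE aE.
have ry : proj_rep y (\sum_(i in frame_set) (alpha i)^-1 *: f i).
  rewrite (sum_frame_set (fun i => (alpha i)^-1)).
  rewrite (_ : \row__ _ = \row_k (a 0 k)^-1).
    exact: rep_transport ub.
  by apply/rowP=> k; rewrite mxE [RHS]mxE aE.
split; first by exists alpha; split.
exists (fun i => (alpha i)^-1); split=> // [i iF|].
  by rewrite invr_eq0 alpha0.
by under eq_bigr => i _ do rewrite invrK.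
Qed.

Lemma cremona_rep (x y : proj_space K r) u :
  cremona frame_set f f x y -> proj_rep y u ->
  proj_rep x (cremona_vec (frame phi M) u).
Proof.
set B := frame phi M => -[alpha [alpha0 xa ya]] yu.
apply: rep_transport xa _.
rewrite (sum_frame_set (fun i => (alpha i)^-1)) in ya.
have := cremona_vec_proportional B (rep_proportional yu ya).
move/proportional_trans; apply; rewrite sum_frame_set.
have a0 k : (\row_k (alpha (phi k))^-1) 0 k != 0.
  by rewrite mxE invr_eq0 alpha0 // mem_frame_set codom_f.
apply: (proportional_trans (cremona_vecE B0 a0)).
suff -> : \row_i ((\row_k (alpha (phi k))^-1 : 'rV[K]_r.+1) 0 i)^-1 =
    \row_k alpha (phi k) by exists 1; rewrite ?oner_eq0 ?scale1r.
by apply/rowP=> k; rewrite !mxE invrK.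
Qed.

End CremonaRelation.

End Geometry.

Definition points (K : fieldType) (r s : nat) (M : 'M[K]_(s, r.+1)) : config K r s :=
  fun i => point (row i M).

(** The step is read backwards, from the transformed configuration to [M], since the curves are
    pushed from deep levels down to level 0. *)
Lemma cremona_between_step (K : fieldType) (r s : nat) (phi : 'I_r.+1 -> 'I_s)
    (M : 'M[K]_(s, r.+1)) :
  injective phi -> framed phi M ->
  cremona_between (frame_set phi) (points (cremona_step phi M)) (points M)
    (fun i => row i M) (fun i => row i M).
Proof.
move=> phi_inj frM; have [B0 coord0] := frM.
have rep_frame i : i \in frame_set phi ->
    proj_rep (points (cremona_step phi M) i) (row i M) /\ proj_rep (points M i) (row i M).
  rewrite mem_frame_set => iF; have := point_rep (framed_row_neq0 i frM).
  by rewrite /points row_cremona_step iF.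
split; first exact: card_frame_set.
- by split=> [i /rep_frame[]|] //; exact: (frame_set_full phi_inj B0).
- by split=> [i /rep_frame[]|] //; exact: (frame_set_full phi_inj B0).
move=> i; rewrite mem_frame_set => iF.
have xu := point_rep (framed_row_neq0 i frM).
have yu : proj_rep (points (cremona_step phi M) i)
    (cremona_vec (frame phi M) (row i M)).
  rewrite /points row_cremona_step (negPf iF); apply: point_rep.
  apply/eqP => Z; have := cremona_vec_coord B0 (coord0 i iF) ord0.
  by rewrite Z /frame_coord mul0mx mxE eqxx.
by have [] := cremona_relation phi_inj B0 (coord0 i iF) xu yu.
Qed.

Local Open Scope classical_set_scope.

(** * Images of lines *)

Lemma zariski_closed_vanishing (K : fieldType) (m n : nat) (T : Type)
    (rep : T -> 'M[K]_(m, n) -> Prop) (f : 'M[K]_(m, n) -> K) :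
  mx_polynomial f -> zariski_closed rep [set t | forall M, rep t M -> f M = 0].
Proof.
case=> F fF; exists [set F] => t; split=> [ft M tM _ ->|ft M tM].
  by rewrite fF ft.
by rewrite -fF; apply: (ft M tM).
Qed.

Lemma sub_zariski_closure (K : fieldType) (m n : nat) (T : Type)
    (rep : T -> 'M[K]_(m, n) -> Prop) (A : set T) : A `<=` zariski_closure rep A.
Proof. by move=> t At Z _; exact. Qed.

Section WeylCurves.
Variables (K : fieldType) (r s : nat) (fr : nat -> 'I_r.+1 -> 'I_s).
Variables (M : 'M[K]_(s, r.+1)) (w : K) (l : nat) (k0 k1 k2 : 'I_r.+1).
Hypothesis fr_inj : forall j, injective (fr j).
Hypothesis framedM : forall j, (j <= l)%N -> framed (fr j) (level fr M j).
Hypotheses (k01 : k0 != k1) (k02 : k0 != k2) (k12 : k1 != k2) (w0 : w != 0).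
Let a := fr l k0.
Let b := fr l k1.
Hypothesis descM : descends fr a b M w l l.

Let z k := descend fr a b M w l k.
Let B := level_frame fr M.

Let B0 j : (j <= l)%N -> \det (B j) != 0.
Proof. by move=> /framedM[]. Qed.

Lemma descend0_coord k : frame_coord (B l) (z 0) 0 k =
  \det (B l) * ((k0 == k)%:R + w * (k1 == k)%:R).
Proof. by rewrite /z /= -[row a _]scale1r frame_coord_line mul1r. Qed.

Lemma descend_coord k i : (k < l)%N ->
  frame_coord (B (l - k.+1)) (z k.+1) 0 i != 0.
Proof.
move=> kl; apply: cremona_vec_coord => [|i']; first by apply: B0; lia.
exact: descM.
Qed.

Lemma descend_neq0 k : (k <= l)%N -> z k != 0.
Proof.
case: k => [_|k kl].
  apply/eqP => Z; have := descend0_coord k0.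
  rewrite Z /frame_coord mul0mx mxE eqxx [k1 == _]eq_sym (negPf k01).
  by rewrite mulr0 addr0 mulr1 => /esym/eqP; rewrite (negPf (B0 _)).
apply/eqP => Z; have := descend_coord ord0 kl.
by rewrite Z /frame_coord mul0mx mxE eqxx.
Qed.

(** The starting point has exactly two nonzero coordinates in its frame, whereas a frame point has
    one and the other points have all of them. Later, an image has all coordinates nonzero, which
    excludes the base points; the other points are excluded by applying the involution and
    induction. This keeps the image away from the exceptional divisors. *)
Lemma descend_not_row k i : (k <= l)%N ->
  ~ proportional (z k) (row i (level fr M (l - k))).
Proof.
elim: k => [_|k IH kl] [c c0 zE].
  rewrite subn0 in zE.
  have coordE k' : \det (B l) * ((k0 == k')%:R + w * (k1 == k')%:R) =
      c * frame_coord (B l) (row i (level fr M l)) 0 k'.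
    by rewrite -descend0_coord zE frame_coordZ mxE.
  have [/codomP[k' iE]|iN] := boolP (i \in codom (fr l)); last first.
    have [_ /(_ i iN k2) cN0] := framedM (leqnn l).
    have := coordE k2; rewrite (negPf k02) (negPf k12) mulr0 addr0 mulr0.
    by move/esym/eqP; rewrite mulf_eq0 (negPf c0) (negPf cN0).
  have {}coordE k : k' != k -> (k0 == k)%:R + w * (k1 == k)%:R = 0.
    move=> kk; have := coordE k; rewrite iE -row_frame frame_coord_row.
    rewrite (negPf kk) !mulr0 => /eqP; rewrite mulf_eq0 (negPf (B0 _)) //=.
    by move/eqP.
  have [kk|kk] := eqVneq k' k0.
    have := coordE k1; rewrite kk => /(_ k01) /eqP.
    by rewrite (negPf k01) eqxx add0r mulr1 (negPf w0).
  have := coordE k0 kk; rewrite eqxx eq_sym (negPf k01) mulr0 addr0.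
  by move/eqP; rewrite oner_eq0.
have jE : (l - k = (l - k.+1).+1)%N by lia.
have [iF|iN] := boolP (i \in codom (fr (l - k.+1))); last first.
  apply: (IH (ltnW kl)); rewrite jE /= row_cremona_step (negPf iN).
  apply: proportional_trans (proportional_sym _) _.
    by apply: (cremona_vecK (B := B (l - k.+1))); [apply: B0; lia | exact: descM].
  by apply: cremona_vec_proportional; exists c.
case/codomP: iF zE => k' ->; rewrite -row_frame => zE.
have [k3 k3N] : exists k3, k' != k3.
  by have [->|] := eqVneq k' k0; [exists k1 | exists k0].
have := descend_coord k3 kl; rewrite zE frame_coordZ mxE frame_coord_row.
by rewrite (negPf k3N) !mulr0 eqxx.
Qed.

(** For j + k = l this is the pullback to level j of the equation of a coordinate hyperplane of
    level l that contains the line. It separates the curves obtained from different levels. *)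
Definition trace (j k : nat) (u : 'rV[K]_r.+1) : K :=
  frame_coord (B l) (ascend fr M j k u) 0 k2.

Lemma trace_algebra (T : Type) (P : (T -> K) -> Prop) (U : T -> 'rV[K]_r.+1) j k :
  function_algebra P -> mx_in_algebra P U -> P (fun x => trace j k (U x)).
Proof.
move=> algP PU; apply: (algebra_frame_coord algP).
  exact: mx_in_algebra_cst.
exact: (algebra_ascend fr algP j k (mx_in_algebra_cst M algP) PU).
Qed.

Lemma weyl_curve_descend k : (k <= l)%N ->
  exists C, [/\ weyl_curve (points (level fr M (l - k))) C, C (point (z k)) &
    forall x u, C x -> proj_rep x u -> trace (l - k) k u = 0].
Proof.
elim: k => [_|k IH kl].
  exists (line_through (points (level fr M (l - 0)) a) (points (level fr M (l - 0)) b)).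
  rewrite subn0; have rowN0 i := framed_row_neq0 i (framedM (leqnn l)).
  have ra := point_rep (rowN0 a); have rb := point_rep (rowN0 b).
  split.
  - apply: weyl_curve_line => ab.
    have [c c0 abE] : proportional (row a (level fr M l)) (row b (level fr M l)).
      by apply: rep_proportional ra _; rewrite -[point _]/(points _ _) ab.
    have := frame_coord_line (fr l) (level fr M l) k0 k1 k0 1 (- c).
    rewrite scale1r abE scaleNr subrr /frame_coord mul0mx mxE eqxx.
    rewrite [k1 == _]eq_sym (negPf k01) mulr0 addr0 mulr1 mulr1.
    by move/esym/eqP; rewrite (negPf (B0 _)).
  - rewrite /line_through /= (point_rep (descend_neq0 (leq0n l))).
    rewrite /points ra rb -memvE memvD ?memvZ //.
      by apply: (subvP (addvSl _ _)); exact: memv_line.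
    by apply: (subvP (addvSr _ _)); exact: memv_line.
  - move=> x u /= xab xu; have : (<[u]> <= <[row a (level fr M l)]> + <[row b (level fr M l)]>)%VS.
      by rewrite -ra -rb -xu.
    rewrite -memvE => /memv_addP[_ /vlineP[c0 ->] [_ /vlineP[c1 ->] ->]].
    by rewrite /trace /= frame_coord_line (negPf k02) (negPf k12) !mulr0 addr0 mulr0.
have [C [wC Cz Ctr]] := IH (ltnW kl).
set j := (l - k.+1)%N; have jE : (l - k = j.+1)%N by rewrite /j; lia.
have jl : (j <= l)%N by rewrite /j; lia.
pose f i := row i (level fr M j).
have := point_rep (descend_neq0 (ltnW kl)) => zk.
have := point_rep (descend_neq0 kl) => zk1.
have [rel _] := cremona_relation (@fr_inj j) (B0 jl) (descM kl) zk zk1.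
exists (zariski_closure (@proj_rep K r)
  [set y | exists2 x, C x & cremona (frame_set (fr j)) f f x y]).
rewrite jE in wC Ctr; split.
- apply: weyl_curve_cremona wC _ _; last by exists (point (z k)), (point (z k.+1)).
  exact: cremona_between_step (@fr_inj j) (framedM jl).
- by apply: sub_zariski_closure; exists (point (z k)).
move=> x u Cx xu.
(* The vanishing of the trace is a closed condition, so it need only be checked before taking the
   closure. *)
apply: (Cx [set y | forall v, proj_rep y v -> trace j k.+1 v = 0]) xu.
  apply: zariski_closed_vanishing; apply: trace_algebra.
    exact: mx_polynomial_algebra.
  exact: mx_polynomial_entry.
move=> y [x' Cx' x'y] v yv.
exact: (Ctr _ _ Cx' (cremona_rep (@fr_inj j) (B0 jl) x'y yv)).
Qed.

Lemma weyl_line_descend (p : config K r s) : config_rep p M ->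
  exists D : set (blowup p), [/\ weyl_line D,
    exists y N, [/\ D y, blowup_rep y N & row ord0 N = z l] &
    forall y N, D y -> blowup_rep y N -> trace 0 l (row ord0 N) = 0].
Proof.
move=> pM; have [C [wC Cz Ctr]] := weyl_curve_descend (leqnn l).
rewrite subnn in wC Ctr.
have pE : points M = p by apply: funext => i; exact: point_eq (pM i).
rewrite pE in wC; exists (proper_transform (p := p) C); split.
- by exists C.
- have zl0 := descend_neq0 (leqnn l); have zl := point_rep zl0.
  have zp i : ~ proportional (z l) (row i M).
    by have := @descend_not_row l i (leqnn l); rewrite subnn.
  (* Away from the points p_i, the line l_i of the incidence variety can only be the span of p_i and
     [z l]. *)
  have lineP : [forall i, [&& \dim ([ffun i => (val (p i) + <[z l]>)%VS] i) == 2%N,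
      (val (point (z l)) <= [ffun i => (val (p i) + <[z l]>)%VS] i)%VS &
      (val (p i) <= [ffun i => (val (p i) + <[z l]>)%VS] i)%VS]].
    apply/forallP=> i; rewrite ffunE zl addvSl addvSr !andbT.
    have pi0 := rep_neq0 (pM i).
    rewrite dimv_disjoint_sum; first by rewrite (eqP (valP (p i))) dim_vline zl0.
    apply/eqP; rewrite -subv0; apply/subvP=> v; rewrite memv_cap (pM i).
    case/andP=> /vlineP[c ->] /vlineP[d cd]; rewrite memv0.
    apply/negPn/negP=> v0; apply: (zp i).
    have d0 : d != 0 by apply: contra_neq v0 => d0; rewrite cd d0 scale0r.
    have c0 : c != 0 by apply: contra_neq v0 => ->; rewrite scale0r.
    exists (d^-1 * c); first by rewrite mulf_neq0 ?invr_eq0.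
    by rewrite -scalerA cd scalerA mulVf ?scale1r.
  pose y : blowup p := exist _ (point (z l), [ffun i => (val (p i) + <[z l]>)%VS]) lineP.
  exists y, (\matrix_(i < s.+1) z l); split; last by rewrite rowK.
    apply: sub_zariski_closure; split=> // i yp; apply: (zp i).
    by apply: rep_proportional zl _; rewrite -[point _]/(blowdown y) yp; exact: pM.
  by split=> [|i]; rewrite rowK // ffunE.
- move=> y N Dy yN.
  apply: (Dy [set y | forall N, blowup_rep y N -> trace 0 l (row ord0 N) = 0]) yN.
    apply: zariski_closed_vanishing; apply: trace_algebra.
      exact: mx_polynomial_algebra.
    by move=> i j; have := @mx_polynomial_entry K s.+1 r.+1 ord0 j;
      congr mx_polynomial; apply: funext => N'; rewrite mxE.
  by move=> y' [Cy' _] N' [y'N' _]; exact: Ctr y'N'.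
Qed.

End WeylCurves.

(** * Conditions expressed by one nonvanishing polynomial *)

Section PrincipalOpen.
Variables (K : fieldType) (m n : nat).
Implicit Types (Q : 'M[K]_(m, n) -> Prop).

Definition principal_open Q : Prop :=
  exists2 f : 'M[K]_(m, n) -> K, mx_polynomial f & forall M, Q M <-> f M != 0.

Lemma principal_open_neq0 (f : 'M[K]_(m, n) -> K) :
  mx_polynomial f -> principal_open (fun M => f M != 0).
Proof. by exists f. Qed.

Lemma principal_open_and Q Q' :
  principal_open Q -> principal_open Q' -> principal_open (fun M => Q M /\ Q' M).
Proof.
case=> [f Pf fE] [g Pg gE]; exists (fun M => f M * g M).
  exact: (algebra_mul (@mx_polynomial_algebra K m n) Pf Pg).
move=> M; rewrite mulf_eq0 negb_or fE gE; split=> [[-> ->] //|].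
by case/andP.
Qed.

Lemma principal_open_forall (I : finType) (Q : I -> 'M[K]_(m, n) -> Prop) :
  (forall i, principal_open (Q i)) -> principal_open (fun M => forall i, Q i M).
Proof.
move=> openQ.
have /boolp.choice[f fP] : forall i, exists g : 'M[K]_(m, n) -> K,
    mx_polynomial g /\ forall M, Q i M <-> g M != 0.
  by move=> i; have [g] := openQ i; exists g.
exists (fun M => \prod_i f i M).
  apply: (algebra_prod (@mx_polynomial_algebra K m n)) => i; exact: (fP i).1.
move=> M; split=> [QM|/prodf_neq0 fM i]; last by apply/(fP i).2/fM.
by apply/prodf_neq0 => i _; apply/(fP i).2/QM.
Qed.

Lemma principal_open_imp (b : bool) Q :
  principal_open Q -> principal_open (fun M => b -> Q M).
Proof.
case: b => [[f Pf fE]|_].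
  by exists f => // M; rewrite -fE; split=> [|? _ //]; exact.
exists (fun=> 1); first exact: (algebra_cst (@mx_polynomial_algebra K m n) 1).
by move=> M; rewrite oner_eq0.
Qed.

Lemma principal_open_lt (N : nat) (Q : nat -> 'M[K]_(m, n) -> Prop) :
  (forall i, (i < N)%N -> principal_open (Q i)) ->
  principal_open (fun M => forall i, (i < N)%N -> Q i M).
Proof.
move=> openQ.
have [f Pf fE] := @principal_open_forall 'I_N (fun i => Q i)
  (fun i => openQ i (ltn_ord i)).
exists f => // M; rewrite -fE; split=> [QM i|QM i iN]; first exact: QM.
exact: (QM (Ordinal iN)).
Qed.

End PrincipalOpen.

(** * From one good configuration to very general ones *)

Section VeryGeneral.
Variables (K : fieldType) (r s : nat) (fr : nat -> 'I_r.+1 -> 'I_s).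
Variables (k0 k1 k2 : 'I_r.+1).
Hypothesis fr_inj : forall j, injective (fr j).
Hypotheses (k01 : k0 != k1) (k02 : k0 != k2) (k12 : k1 != k2).

Definition descends_below (m : nat) (w : nat -> K) (M : 'M[K]_(s, r.+1)) : Prop :=
  (forall j, (j < m)%N -> framed (fr j) (level fr M j)) /\
  (forall l, (l < m)%N -> ~~ odd l -> descends fr (fr l k0) (fr l k1) M (w l) l l).

Lemma descends_below_open m w : principal_open (descends_below m w).
Proof.
have algP := @mx_polynomial_algebra K s r.+1.
have algid := @mx_polynomial_entry K s r.+1.
apply: principal_open_and; apply: principal_open_lt => j jm.
  apply: principal_open_and.
    apply: principal_open_neq0; apply: (algebra_det algP).
    exact: (algebra_level_frame fr algP j algid).
  apply: principal_open_forall => i; apply: principal_open_imp.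
  apply: principal_open_forall => k; apply: principal_open_neq0.
  apply: (algebra_frame_coord algP).
    exact: (algebra_level_frame fr algP j algid).
  exact: (algebra_row _ (algebra_level fr algP j algid)).
apply: principal_open_imp; apply: principal_open_lt => k kj.
apply: principal_open_forall => i; apply: principal_open_neq0.
apply: (algebra_frame_coord algP).
  exact: (algebra_level_frame fr algP _ algid).
apply: (algebra_descend fr algP _ _ _ _ algid); exact: algebra_cst.
Qed.

(** If there were only n curves, the levels 0, 2, ..., 2n would give n + 1 distinct ones. Only
    finitely many steps are used at a time, so the representative [M] and the parameters [w] may
    depend on the bound. *)
Lemma weyl_lines_infinite (p : config K r s) :
  (forall m, exists M w, [/\ config_rep p M, forall l, w l != 0 & descends_below m w M]) ->
  infinite_set [set D : set (blowup p) | weyl_line D].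
Proof.
move=> pW [n nE]; have [M [w [pM w0 [frM dM]]]] := pW n.+1.*2.
have frMl l : (l <= n)%N -> forall j, (j <= l.*2)%N -> framed (fr j) (level fr M j).
  by move=> ln j jl; apply: frM; lia.
have dMl l : (l <= n)%N -> descends fr (fr l.*2 k0) (fr l.*2 k1) M (w l.*2) l.*2 l.*2.
  by move=> ln; apply: dM; rewrite ?odd_double //; lia.
pose P l (D : set (blowup p)) := [/\ weyl_line D,
  exists y N, [/\ D y, blowup_rep y N &
    row ord0 N = descend fr (fr l.*2 k0) (fr l.*2 k1) M (w l.*2) l.*2 l.*2] &
  forall y N, D y -> blowup_rep y N -> trace fr M l.*2 k2 0 l.*2 (row ord0 N) = 0].
have /boolp.choice[f fP] : forall l, exists D, (l <= n)%N -> P l D.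
  (* Beyond n nothing is claimed, and [setT] is a default value. *)
  move=> l; have [ln|ln] := leqP l n; last by exists setT.
  have [D DP] := weyl_line_descend fr_inj (frMl l ln) k01 k02 k12 (w0 _) (dMl l ln) pM.
  by exists D.
have f_lt l l' : (l < l' <= n)%N -> f l <> f l'.
  case/andP=> ll' l'n ff; have ln : (l <= n)%N by lia.
  have [_ [y [N [fy yN rowN]]] _] := fP l' l'n.
  have [_ _ /(_ y N)] := fP l ln; rewrite ff => /(_ fy yN)/eqP; apply/negP.
  rewrite rowN /trace.
  (* The distinguished point of the curve from level 2l' climbs back to level 2l. There it has just
     left a step based at the frame of level 2l, so all its coordinates in that frame are nonzero
     and the trace cannot vanish. *)
  have := @ascend_descend K r s fr (fr l'.*2 k0) (fr l'.*2 k1) M (w l'.*2) l'.*2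
    l.*2 (l'.*2 - l.*2).
  rewrite subnK ?leq_double ?(ltnW ll') // subnn => /(_ _ _ (dMl _ l'n)).
  case=> // [i il|c c0 ->]; first by apply: (frMl l' l'n); lia.
  rewrite frame_coordZ mxE mulf_neq0 //.
  have := descend_coord (frMl l' l'n) k01 k02 k12 (w0 _) (dMl l' l'n) k2
    (k := (l'.*2 - l.*2).-1).
  rewrite prednK ?subn_gt0 ?ltn_double // subKn ?leq_double ?(ltnW ll') //.
  by apply; lia.
have f_inj : {in `I_n.+1 &, injective f}.
  move=> l l'; rewrite !inE /= !ltnS => ln l'n ff.
  by case: (ltngtP l l') => // h; [have := @f_lt l l' | have := @f_lt l' l];
    rewrite h ff => /(_ _)[].
have : (`I_n.+1 #<= `I_n)%card.
  rewrite -(card_le_eqr nE) -(card_le_eql (inj_card_eq f_inj)).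
  apply: subset_card_le => _ [l ln <-].
  by have [] := fP l ln.
by rewrite card_le_II ltnn.
Qed.

Lemma very_general_weyl_lines :
  (forall m, exists M w, (forall l, w l != 0) /\ descends_below m w M) ->
  very_general (fun p : config K r s =>
    infinite_set [set D : set (blowup p) | weyl_line D]).
Proof.
move=> witness.
(* The parameters of the witness are frozen, which makes the condition polynomial in [M] alone. *)
have /boolp.choice[w wP] : forall m, exists w : nat -> K,
    (forall l, w l != 0) /\ exists M, descends_below m w M.
  by move=> m; have [M [w [w0 wM]]] := witness m; exists w; split=> //; exists M.
have /boolp.choice[f fP] : forall m, exists g : 'M[K]_(s, r.+1) -> K,
    mx_polynomial g /\ forall M, descends_below m (w m) M <-> g M != 0.
  by move=> m; have [g] := descends_below_open m (w m); exists g.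
(* The bound [m.+1] is positive, so the witness is framed at level 0. Its rows are therefore nonzero
   and represent points, which shows that the closed set is proper. *)
exists (fun m => [set p | forall M, config_rep p M -> f m.+1 M = 0]).
  move=> m; split; first exact: zariski_closed_vanishing (fP _).1.
  have [_ [M wM]] := wP m.+1.
  move=> ZT; have : (setT : set (config K r s)) (points M) by [].
  rewrite -ZT => /(_ M) ZM; have /eqP := iffLR ((fP m.+1).2 M) wM; apply.
  apply: ZM => i; apply: point_rep; apply: framed_row_neq0.
  exact: wM.1 0%N isT.
move=> p pN; apply: weyl_lines_infinite => m.
have /existsNP[M /not_implyP[pM /eqP fM]] := pN m.
exists M, (w m.+1); split=> //; first exact: (wP _).1.
have [frM dM] := iffRL ((fP _).2 M) fM.
by split=> j jm; [apply: frM | apply: dM]; lia.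
Qed.

End VeryGeneral.

Local Close Scope classical_set_scope.

(** * The cuspidal curve and its secant scrolls *)

Lemma size_index_enum_ord (n : nat) : size (index_enum 'I_n) = n.
Proof. by rewrite -sum1_size -[RHS]card_ord -sum1_card. Qed.

(** * Lagrange interpolation and sums of residues *)

Section Interpolation.
Variables (K : fieldType) (r : nat) (t : 'I_r.+1 -> K).
Hypothesis t_inj : injective t.
Implicit Types (g h : {poly K}).

Definition omit_prod (i : 'I_r.+1) : {poly K} := \prod_(l | l != i) ('X - (t l)%:P).

(** The derivative of the product of all X - t_l at t_i, that is, the denominator in Lagrange
    interpolation. *)
Definition node_weight (i : 'I_r.+1) : K := \prod_(l | l != i) (t i - t l).

Let full_prod : {poly K} := \prod_l ('X - (t l)%:P).

Lemma node_weight_neq0 i : node_weight i != 0.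
Proof.
by apply/prodf_neq0 => l li; rewrite subr_eq0; apply: contraNneq li => /t_inj ->.
Qed.

Lemma omit_prod_horner i y : (omit_prod i).[y] = \prod_(l | l != i) (y - t l).
Proof. by rewrite horner_prod; apply: eq_bigr => l _; rewrite hornerXsubC. Qed.

Lemma omit_prod_node i j : (omit_prod i).[t j] = node_weight i * (i == j)%:R.
Proof.
rewrite omit_prod_horner; have [->|ij] := eqVneq i j; first by rewrite mulr1.
by rewrite (bigD1 j) 1?eq_sym //= subrr mul0r mulr0.
Qed.

Lemma size_omit_prod i : size (omit_prod i) = r.+1.
Proof.
rewrite /omit_prod -big_filter size_prod_XsubC; congr _.+1.
by rewrite size_filter -sum1_count sum1_card cardC1 card_ord.
Qed.

Lemma omit_prod_coef_lead i : (omit_prod i)`_r = 1.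
Proof.
have /monicP : omit_prod i \is monic by exact: monic_prod_XsubC.
by rewrite lead_coefE size_omit_prod.
Qed.

Let size_full : size full_prod = r.+2.
Proof. by rewrite /full_prod size_prod_XsubC size_index_enum_ord. Qed.

Let full_coef_lead : full_prod`_r.+1 = 1.
Proof.
have /monicP : full_prod \is monic by exact: monic_prod_XsubC.
by rewrite lead_coefE size_full.
Qed.

Let full_coef : full_prod`_r = - \sum_l t l.
Proof.
have := @coefPn_prod_XsubC _ [seq t l | l <- index_enum 'I_r.+1].
rewrite size_map size_index_enum_ord big_map /= => -> //.
by rewrite big_map.
Qed.

Let full_omit i : full_prod = omit_prod i * ('X - (t i)%:P).
Proof. by rewrite /full_prod (bigD1 i) //= mulrC. Qed.

Let full_node i : full_prod.[t i] = 0.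
Proof. by rewrite (full_omit i) hornerM hornerXsubC subrr mulr0. Qed.

Lemma omit_prod_coef_pred i : (0 < r)%N ->
  (omit_prod i)`_r.-1 = t i - \sum_l t l.
Proof.
move=> r0; have := full_coef; rewrite (full_omit i) mulrBr coefB coefMX coefMC.
by rewrite omit_prod_coef_lead mul1r eqn0Ngt r0 /= => <-; rewrite addrC subrK.
Qed.

Lemma interpolation0 g : (size g <= r.+1)%N -> (forall i, g.[t i] = 0) -> g = 0.
Proof.
move=> sg g0; apply: (@roots_geq_poly_eq0 _ _ [seq t i | i <- enum 'I_r.+1]).
- by apply/allP => _ /mapP[i _ ->]; rewrite /root g0.
- by rewrite map_inj_uniq ?enum_uniq.
- by rewrite size_map -cardE card_ord.
Qed.

(** The residue theorem for g divided by the product of all X - t_l; the right side is the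
    contribution of infinity. *)
Lemma sum_residues g : (size g <= r.+2)%N ->
  \sum_i g.[t i] / node_weight i = g`_r + (\sum_i t i) * g`_r.+1.
Proof.
(* The last term cancels the coefficient of degree r + 1, so [q] has degree at most r and vanishes
   at r + 1 nodes. The coefficient of degree r gives the formula. *)
move=> sg; pose q := \sum_i (g.[t i] / node_weight i) *: omit_prod i
  - g + g`_r.+1 *: full_prod.
have q0 : q = 0.
  apply: interpolation0 => [|i].
    apply/leq_sizeP => j jr; rewrite /q coefD coefB coefZ coef_sum big1 => [|i _].
      have [->|jr1] := eqVneq j r.+1; first by rewrite full_coef_lead mulr1 sub0r addNr.
      have jr2 : (r.+2 <= j)%N by rewrite ltn_neqAle eq_sym jr1.
      have -> : full_prod`_j = 0 by rewrite nth_default ?size_full.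
      by rewrite (leq_sizeP _ _ sg j jr2) mulr0 subrr addr0.
    by rewrite coefZ [_`_j]nth_default ?size_omit_prod ?mulr0.
  rewrite /q hornerD hornerZ full_node mulr0 addr0 hornerD hornerN horner_sum.
  rewrite (bigD1 i) //= big1 => [|j ji].
    rewrite hornerZ omit_prod_node eqxx mulr1 divfK ?node_weight_neq0 //.
    by rewrite addr0 subrr.
  by rewrite hornerZ omit_prod_node (negPf ji) !mulr0.
have := congr1 (coefp r) q0; rewrite /q /coefp coefD coefB coefZ coef0 full_coef.
rewrite coef_sum (eq_bigr (fun i => g.[t i] / node_weight i)) => [|i _].
  by move/eqP; rewrite mulrN subr_eq0 subr_eq => /eqP ->; ring.
by rewrite coefZ omit_prod_coef_lead mulr1.
Qed.

End Interpolation.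

(** * Hyperplanes and frames of the cuspidal curve *)

Section CuspidalCurve.
Variables (K : fieldType) (r : nat).
Hypothesis r3 : (3 <= r)%N.
Implicit Types (g h : {poly K}) (v : 'rV[K]_r.+1).

(* A rational curve of degree [r + 1] in P^r with a cusp at infinity: hyperplanes
   cut it in points whose parameters have sum [eta]. *)
Definition cusp (eta y : K) : 'rV[K]_r.+1 :=
  \row_j (if (j < r)%N then y ^+ j else y ^+ r.+1 - eta * y ^+ r).

(** These are the restrictions of linear forms to the curve; in degree r + 1 the second condition
    says that the roots have sum [eta]. *)
Definition hyperplane_poly (eta : K) g : Prop :=
  (size g <= r.+2)%N /\ g`_r = - eta * g`_r.+1.

(** The value at [v] of the linear form belonging to [g]. The coefficient of degree r is left out,
    being determined by the one of degree r + 1. *)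
Definition pairing v g : K :=
  \sum_(j < r.+1) v 0 j * g`_(if (j < r)%N then j : nat else r.+1).

Lemma pairing_cusp eta y g : hyperplane_poly eta g ->
  pairing (cusp eta y) g = g.[y].
Proof.
case=> sg gr; rewrite (horner_coef_wide _ sg) /pairing big_ord_recr /=.
rewrite big_ord_recr big_ord_recr /= !mxE /= ltnn gr.
rewrite (eq_bigr (fun i : 'I_r => g`_i * y ^+ i)) => [|i _].
  by rewrite [y ^+ r.+1]exprS; ring.
by rewrite !mxE /= ltn_ord mulrC.
Qed.

Lemma pairing_sum (I : finType) (a : I -> K) (u : I -> 'rV[K]_r.+1) g :
  pairing (\sum_i a i *: u i) g = \sum_i a i * pairing (u i) g.
Proof.
rewrite /pairing; under [RHS]eq_bigr => i _ do rewrite mulr_sumr.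
rewrite exchange_big /=; apply: eq_bigr => j _.
rewrite summxE mulr_suml; apply: eq_bigr => i _.
by rewrite mxE mulrA.
Qed.

Definition row_poly (eta : K) v : {poly K} :=
  \poly_(i < r.+2) (if (i < r)%N then v 0 (inord i)
                    else if i == r then - eta * v 0 ord_max else v 0 ord_max).

Lemma row_poly_hyperplane eta v : hyperplane_poly eta (row_poly eta v).
Proof.
split; first exact: size_poly.
by rewrite !coef_poly !ltnS leqnSn leqnn ltnn eqxx ltnNge leqnSn /= gtn_eqF.
Qed.

Lemma pairing_row_poly eta u v : pairing u (row_poly eta v) = \sum_j u 0 j * v 0 j.
Proof.
apply: eq_bigr => j _; congr (_ * _); rewrite coef_poly.
have [jr|jr] := ltnP j r; first by rewrite jr inord_val (ltn_trans jr).
rewrite ltnS leqnn ltnNge leqnSn /= gtn_eqF //; congr (v _ _).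
by apply/val_inj => /=; apply/eqP; rewrite eqn_leq jr -ltnS ltn_ord.
Qed.

Lemma pairing_ext eta u v :
  (forall g, hyperplane_poly eta g -> pairing u g = pairing v g) -> u = v.
Proof.
have pairing_delta w j : pairing w (row_poly eta (delta_mx 0 j)) = w 0 j.
  rewrite pairing_row_poly (bigD1 j) //= big1 => [|i ij].
    by rewrite mxE !eqxx mulr1 addr0.
  by rewrite mxE (negPf ij) andbF mulr0.
move=> uv; apply/rowP=> j.
by have := uv _ (row_poly_hyperplane eta (delta_mx 0 j)); rewrite !pairing_delta.
Qed.

Section Frame.
Variables (t : 'I_r.+1 -> K) (eta : K).
Hypothesis t_inj : injective t.
Let S := \sum_i t i - eta.
Hypothesis S0 : S != 0.

(** The hyperplane through all frame points but the i-th meets the curve once more, at the parameter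
    t_i - S that makes the sum equal to [eta]. *)
Let hyperplane_omit i : hyperplane_poly eta (omit_prod t i * ('X - (t i - S)%:P)).
Proof.
have r0 : (0 < r)%N by lia.
split.
  rewrite (leq_trans (size_polyMleq _ _)) // size_omit_prod size_XsubC addn2 //.
rewrite mulrBr !coefB !coefMX !coefMC /= eqn0Ngt r0 /=.
rewrite omit_prod_coef_pred // omit_prod_coef_lead [_`_r.+1]nth_default.
  by rewrite /S; ring.
by rewrite size_omit_prod.
Qed.

(** The residue formula gives S times the leading coefficient equal to 0, so the degree drops to r
    and r + 1 roots are too many. Thus S != 0 means that the nodes span the space. *)
Lemma hyperplane_poly0 g :
  hyperplane_poly eta g -> (forall i, g.[t i] = 0) -> g = 0.
Proof.
case=> sg gr g0; have := sum_residues t_inj sg.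
rewrite big1 => [|i _]; last by rewrite g0 mul0r.
rewrite gr -mulrDl addrC -/S => /esym/eqP; rewrite mulf_eq0 (negPf S0) /= => /eqP g1.
apply: (interpolation0 t_inj) => //; apply/leq_sizeP => j jr.
have [->//|jr1] := eqVneq j r.+1.
by rewrite (leq_sizeP _ _ sg) // ltn_neqAle eq_sym jr1.
Qed.

(** The hyperplanes through all frame points but one form, up to scalars, the dual basis; their
    values at [y] are the coordinates. *)
Lemma cusp_expansion y : cusp eta y =
  \sum_i ((\prod_(l | l != i) (y - t l)) * (y - t i + S) / (node_weight t i * S))
    *: cusp eta (t i).
Proof.
apply: (@pairing_ext eta) => g gE; rewrite pairing_sum pairing_cusp //.
pose q := \sum_i (g.[t i] / (node_weight t i * S)) *:
  (omit_prod t i * ('X - (t i - S)%:P)) - g.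
have q0 : q = 0.
  apply: hyperplane_poly0 => [|i].
    split.
      rewrite (leq_trans (size_polyD _ _)) // size_polyN geq_max gE.1 andbT.
      rewrite (leq_trans (size_sum _ _ _)) //; apply/bigmax_leqP => i _.
      by rewrite (leq_trans (size_scale_leq _ _)) // (hyperplane_omit i).1.
    rewrite !coefB !coef_sum gE.2 mulrBr mulr_sumr; congr (_ - _).
    by apply: eq_bigr => i _; rewrite !coefZ (hyperplane_omit i).2 mulrCA.
  rewrite /q hornerD hornerN horner_sum (bigD1 i) //= big1 => [|j ji].
    rewrite hornerZ hornerM omit_prod_node eqxx mulr1 hornerXsubC subKr.
    by rewrite divfK ?mulf_neq0 ?node_weight_neq0 // addr0 subrr.
  by rewrite hornerZ hornerM omit_prod_node (negPf ji) mulr0 mul0r mulr0.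
have := congr1 (horner^~ y) q0.
rewrite /q hornerD hornerN horner_sum horner0 => /eqP; rewrite subr_eq0 => /eqP <-.
apply: eq_bigr => i _; rewrite pairing_cusp // hornerZ hornerM hornerXsubC.
by rewrite omit_prod_horner opprB addrA; ring.
Qed.

Definition cusp_frame : 'M[K]_r.+1 := \matrix_i cusp eta (t i).

Lemma det_cusp_frame : \det cusp_frame != 0.
Proof.
rewrite -det_tr; apply/det0P => -[v v0 vM]; case/eqP: v0.
have g0 : row_poly eta v = 0.
  apply: hyperplane_poly0 => [|i]; first exact: row_poly_hyperplane.
  rewrite -(pairing_cusp (t i) (row_poly_hyperplane eta v)) pairing_row_poly.
  move/rowP/(_ i): vM; rewrite !mxE; apply: etrans.
  by apply: eq_bigr => j _; rewrite !mxE mulrC.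
apply/rowP=> j; have := pairing_row_poly eta (delta_mx 0 j) v.
rewrite g0 /pairing big1 => [|k _]; last by rewrite coef0 mulr0.
rewrite (bigD1 j) //= big1 => [|k kj]; last by rewrite mxE eqxx (negPf kj) mul0r.
by rewrite !mxE !eqxx mul1r addr0 => <-.
Qed.

End Frame.

End CuspidalCurve.

(** * The scroll of secants with a given parameter sum *)

Section Scroll.
Variables (K : fieldType) (r : nat).
Hypothesis r3 : (3 <= r)%N.
Implicit Types (g h : {poly K}) (v : 'rV[K]_r.+1) (c d : K * K).

Definition quad (sigma : K) c : {poly K} := c.1%:P + c.2 *: ('X^2 - sigma *: 'X).

Lemma horner_quad sigma c y : (quad sigma c).[y] = c.1 + c.2 * (y ^+ 2 - sigma * y).
Proof. by rewrite /quad !hornerE. Qed.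

Lemma size_quad sigma c : (size (quad sigma c) <= 3)%N.
Proof.
rewrite (leq_trans (size_polyD _ _)) // geq_max (leq_trans (size_polyC_leq1 _)) //=.
rewrite (leq_trans (size_scale_leq _ _)) // (leq_trans (size_polyD _ _)) //.
rewrite size_polyN size_polyXn geq_max leqnn (leq_trans (size_scale_leq _ _)) //.
by rewrite size_polyX.
Qed.

Lemma coef_quad_mul sigma c h j : (quad sigma c * h)`_j.+2 =
  c.1 * h`_j.+2 + c.2 * (h`_j - sigma * h`_j.+1).
Proof.
rewrite mulrDl coefD coefCM -scalerAl coefZ mulrBl coefB -scalerAl coefZ.
by rewrite coefXM coefXnM /= subSS subSS subn0.
Qed.

(* The union of the secants of the cuspidal curve whose end points have
   parameters of sum [sigma], together with its limits: a surface scroll.  The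
   quadratic polynomial of [c] vanishes at the two end points. *)
Definition scroll (eta sigma : K) v : Prop :=
  exists2 c, c != 0 & forall h, (size h <= r)%N ->
    h`_r.-2 = - (eta - sigma) * h`_r.-1 -> pairing v (quad sigma c * h) = 0.

Let r2 : r = r.-2.+2. Proof. by lia. Qed.
Let r1 : r.-1 = r.-2.+1. Proof. by lia. Qed.

Lemma coef_quad_mul_top sigma c h : (size h <= r)%N ->
  (quad sigma c * h)`_r = c.2 * (h`_r.-2 - sigma * h`_r.-1) /\
  (quad sigma c * h)`_r.+1 = c.2 * h`_r.-1.
Proof.
move=> sh; have Z j : (r <= j)%N -> h`_j = 0.
  by move=> rj; rewrite nth_default ?(leq_trans sh).
split; rewrite {1}r2 coef_quad_mul -r2 -r1 ?(Z r.+1) ?(Z r) //; ring.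
Qed.

Lemma hyperplane_quad_mul eta sigma c h : (size h <= r)%N ->
  h`_r.-2 = - (eta - sigma) * h`_r.-1 -> hyperplane_poly r eta (quad sigma c * h).
Proof.
move=> sh hr; split.
  rewrite (leq_trans (size_polyMleq _ _)) //; have := size_quad sigma c; lia.
by have [-> ->] := coef_quad_mul_top sigma c sh; rewrite hr; ring.
Qed.

Section Frame.
Variables (t : 'I_r.+1 -> K) (eta : K).
Hypothesis t_inj : injective t.
Let S := \sum_i t i - eta.

(** The defining equations of the scroll are vanishing sums of residues. They force the interpolant
    of the values on the left to be a quadratic polynomial with root sum [sigma + S]. A point of the
    scroll is thus a quotient of two quadratics at the nodes, and inverting coordinates will
    exchange the two. *)
Lemma scroll_frameP sigma (a : 'I_r.+1 -> K) :
  scroll eta sigma (\sum_i a i *: cusp r eta (t i)) <->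
  exists2 c, c != 0 & exists d, forall i,
    a i * node_weight t i * (quad sigma c).[t i] = (quad (sigma + S) d).[t i].
Proof.
have pairE c h : (size h <= r)%N -> h`_r.-2 = - (eta - sigma) * h`_r.-1 ->
    pairing (\sum_i a i *: cusp r eta (t i)) (quad sigma c * h) =
    \sum_i a i * ((quad sigma c).[t i] * h.[t i]).
  move=> sh hr; rewrite pairing_sum; apply: eq_bigr => i _.
  by rewrite pairing_cusp ?hornerM //; exact: hyperplane_quad_mul.
have w0 := node_weight_neq0 t_inj.
split=> -[c c0 cP].
  exists c => //; pose b i := a i * node_weight t i * (quad sigma c).[t i].
  pose N : {poly K} := \sum_i (b i / node_weight t i) *: omit_prod t i.
  have Nt i : N.[t i] = b i.
    rewrite horner_sum (bigD1 i) //= big1 => [|j ji].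
      by rewrite hornerZ omit_prod_node eqxx mulr1 divfK ?addr0.
    by rewrite hornerZ omit_prod_node (negPf ji) !mulr0.
  have sN : (size N <= r.+1)%N.
    rewrite (leq_trans (size_sum _ _ _)) //; apply/bigmax_leqP => i _.
    by rewrite (leq_trans (size_scale_leq _ _)) // size_omit_prod.
  have resN h : (size h <= r)%N -> h`_r.-2 = - (eta - sigma) * h`_r.-1 ->
      (size (N * h)%R <= r.+2)%N ->
      (N * h)`_r + (\sum_i t i) * (N * h)`_r.+1 = 0.
    move=> sh hr sNh; rewrite -(sum_residues t_inj sNh) -[RHS](cP h sh hr) pairE //.
    apply: eq_bigr => i _; rewrite hornerM Nt /b.
    by field; exact: w0.
  (* Testing against the monomial of degree k < r - 2 kills the coefficient of degree r - k of [N],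
     so [N] is at most quadratic in the end. *)
  have N_high k : (k <= r - 2)%N -> (size N <= r.+1 - k)%N.
    elim: k => [|k IH] kr; first by rewrite subn0.
    have {}IH := IH (ltnW kr).
    have h_size : size ('X^k : {poly K}) = k.+1 by rewrite size_polyXn.
    have NX j : (N * 'X^k)`_(j + k) = N`_j.
      by rewrite coefMXn ltnNge leq_addl /= addnK.
    have := resN 'X^k; rewrite h_size !coefXn.
    have -> : (r.-2 == k) = false by lia.
    have -> : (r.-1 == k) = false by lia.
    have sNX : (size (N * 'X^k)%R <= r.+2)%N.
      by rewrite (leq_trans (size_polyMleq _ _)) // h_size; lia.
    rewrite mulr0 => /(_ _ erefl sNX).
    have -> : (N * 'X^k)`_r.+1 = 0.
      by rewrite -[r.+1](@subnK k) ?NX; [rewrite nth_default //; lia | lia].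
    rewrite -{2}[r](@subnK k); last by lia.
    rewrite NX mulr0 addr0 => Nk.
    apply/leq_sizeP => j jk; have [->|jN] := eqVneq j (r - k)%N.
      by apply: Nk; lia.
    by rewrite nth_default //; apply: leq_trans IH _; lia.
  have {N_high}sN3 : (size N <= 3)%N by have := N_high _ (leqnn _); lia.
  (* This last test polynomial fixes the linear coefficient of [N], that is, its root sum. *)
  exists (N`_0, N`_2); pose h : {poly K} := 'X^(r.-1) - (eta - sigma) *: 'X^(r.-2).
  have h1 : h`_r.-1 = 1.
    by rewrite coefB coefZ !coefXn eqxx (_ : (_ == r.-2) = false) ?mulr0 ?subr0 //; lia.
  have h2 : h`_r.-2 = - (eta - sigma).
    by rewrite coefB coefZ !coefXn eqxx (_ : (_ == r.-1) = false) ?mulr1 ?sub0r //; lia.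
  have sh : (size h <= r)%N.
    rewrite (leq_trans (size_polyD _ _)) // size_polyN geq_max size_polyXn.
    rewrite (leq_trans (size_scale_leq _ _)) ?size_polyXn ?andbT; lia.
  have := resN h sh; rewrite h1 h2 mulr1 => /(_ erefl) resNh.
  have {resNh} := resNh (leq_trans (size_polyMleq _ _) _).
  have NE : N = (N`_0)%:P + N`_1 *: 'X + N`_2 *: 'X^2.
    apply/polyP => j; rewrite !coefD coefC !coefZ coefX coefXn.
    case: j => [|[|[|j]]] /=; rewrite ?mulr0 ?mulr1 ?addr0 ?add0r //.
    by rewrite nth_default // (leq_trans sN3).
  have Nh (p : {poly K}) j :
      (N * p)`_j.+2 = N`_0 * p`_j.+2 + N`_1 * p`_j.+1 + N`_2 * p`_j.
    rewrite {1}NE !mulrDl !coefD coefCM -!scalerAl !coefZ coefXM coefXnM /=.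
    by rewrite subSS subSS subn0.
  have hZ j : (r <= j)%N -> h`_j = 0 by move=> rj; rewrite nth_default ?(leq_trans sh).
  have -> : (N * h)`_r = N`_1 - N`_2 * (eta - sigma).
    by rewrite {1}r2 Nh -r2 -r1 hZ // h1 h2; ring.
  have -> : (N * h)`_r.+1 = N`_2.
    by rewrite {1}r2 Nh -r2 -r1 (hZ r.+1) ?(hZ r) // h1; ring.
  move=> N1; have {}N1 : N`_1 = - (sigma + S) * N`_2.
    apply/eqP; rewrite -subr_eq0 -[X in _ == X]N1 /S; first by apply/eqP; ring.
    by lia.
  move=> i; rewrite -/(b i) -Nt horner_quad {1}NE !hornerE N1 /S /=; ring.
exists c => // h sh hr; have [d dP] := cP.
have resE : (quad (sigma + S) d * h)`_r + (\sum_i t i) * (quad (sigma + S) d * h)`_r.+1 = 0.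
  by have [-> ->] := coef_quad_mul_top (sigma + S) d sh; rewrite hr /S; ring.
rewrite pairE //; apply: etrans resE; rewrite -(sum_residues t_inj); last first.
  rewrite (leq_trans (size_polyMleq _ _)) //; have := size_quad (sigma + S) d; lia.
apply: eq_bigr => i _; rewrite hornerM -dP.
by field; exact: w0.
Qed.

End Frame.

Lemma secant_scroll eta x y (c0 c1 : K) :
  scroll eta (x + y) (c0 *: cusp r eta x + c1 *: cusp r eta y).
Proof.
exists (x * y, 1) => [|h sh hr].
  by apply/eqP => -[_] /eqP; rewrite oner_eq0.
have hE := hyperplane_quad_mul (x * y, 1) sh hr.
have := pairing_sum (fun b : bool => if b then c0 else c1)
  (fun b => if b then cusp r eta x else cusp r eta y) (quad (x + y) (x * y, 1) * h).
rewrite big_bool big_bool /= => ->.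
by rewrite !(pairing_cusp _ hE) !hornerM !horner_quad /=; ring.
Qed.

End Scroll.

(** * Cremona transformations between cuspidal curves *)

Section CremonaLink.
Variables (K : fieldType) (r : nat).
Hypothesis r3 : (3 <= r)%N.
Implicit Types (B G : 'M[K]_r.+1) (t c : 'I_r.+1 -> K) (eta sigma : K).

Definition on_cusp B t eta G c : Prop :=
  forall i, row i B = c i *: (cusp r eta (t i) *m G).

(* The rows of [B] lie on two cuspidal curves; the last condition says that the
   Cremona transformation in the frame [B] exchanges them. *)
Record cremona_link B t eta G c t' eta' G' c' : Prop := CremonaLink {
  link_inj : injective t;
  link_det : \det B != 0;
  link_unit : G \in unitmx;
  link_unit' : G' \in unitmx;
  link_on : on_cusp B t eta G c;
  link_on' : on_cusp B t' eta' G' c';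
  link_shift : \sum_i t i - eta != 0;
  link_nodes : forall i, t' i = t i - (\sum_i t i - eta);
  link_eta : eta' = eta - (r%:R - 1) * (\sum_i t i - eta);
  link_scale : forall i, c i * c' i * node_weight t i ^+ 2 = 1
}.

Lemma node_weight_shift t t' S :
  (forall i, t' i = t i - S) -> forall i, node_weight t' i = node_weight t i.
Proof. by move=> tE i; apply: eq_bigr => l _; rewrite !tE; ring. Qed.

(** The nodes lose (r + 1) S in total and [eta] loses (r - 1) S, so S changes sign; this makes a
    link symmetric. *)
Lemma shift_opp t t' eta eta' : (forall i, t' i = t i - (\sum_i t i - eta)) ->
  eta' = eta - (r%:R - 1) * (\sum_i t i - eta) ->
  \sum_i t' i - eta' = - (\sum_i t i - eta).
Proof.
move=> tE ->; rewrite (eq_bigr _ (fun i _ => tE i)) big_split /=.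
by rewrite sumr_const card_ord -[in X in _ + X - _]mulr_natl; ring.
Qed.

Lemma link_sym B t eta G c t' eta' G' c' :
  cremona_link B t eta G c t' eta' G' c' -> cremona_link B t' eta' G' c' t eta G c.
Proof.
case=> t_inj B0 uG uG' onB onB' S0 tE etaE cE.
have S' := shift_opp tE etaE.
split=> //; rewrite ?S' ?oppr_eq0 //.
- by move=> i j; rewrite !tE => /addIr /t_inj.
- by move=> i; rewrite tE; ring.
- by rewrite etaE; ring.
- by move=> i; rewrite (node_weight_shift tE) [c' i * _]mulrC cE.
Qed.

Lemma on_cuspE B t eta G c :
  on_cusp B t eta G c -> B = diag_mx (\row_i c i) *m cusp_frame t eta *m G.
Proof.
move=> onB; apply/row_matrixP => i.
rewrite onB -mulmxA row_mul row_diag_mx mxE -scalemxAl -rowE row_mul.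
by rewrite rowK.
Qed.

Lemma on_cusp_det B t eta G c : injective t -> \sum_i t i - eta != 0 ->
  G \in unitmx -> (forall i, c i != 0) -> on_cusp B t eta G c -> \det B != 0.
Proof.
move=> t_inj S0 uG c0 /on_cuspE ->; rewrite !det_mulmx !mulf_neq0 //.
- by rewrite det_diag; apply/prodf_neq0 => i _; rewrite mxE.
- exact: det_cusp_frame.
- by rewrite -unitfE -unitmxE.
Qed.

(** The scalars [c'] are dictated by [link_scale]. The nodes of the target curve again form a frame,
    so there is a matrix [G'] carrying them to the rows of [B]. *)
Lemma exists_link B t eta G c : injective t -> \sum_i t i - eta != 0 ->
  G \in unitmx -> (forall i, c i != 0) -> on_cusp B t eta G c ->
  exists G' c', cremona_link B t eta G c
    (fun i => t i - (\sum_i t i - eta)) (eta - (r%:R - 1) * (\sum_i t i - eta)) G' c'.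
Proof.
move=> t_inj S0 uG c0 onB.
pose t' i := t i - (\sum_i t i - eta).
pose eta' := eta - (r%:R - 1) * (\sum_i t i - eta).
have B0 := on_cusp_det t_inj S0 uG c0 onB.
have w0 := node_weight_neq0 t_inj.
pose c' i := (c i * node_weight t i ^+ 2)^-1.
have c'0 i : c' i != 0 by rewrite invr_eq0 mulf_neq0 // expf_neq0.
have t'_inj : injective t' by move=> i j /addIr /t_inj.
have F0 : cusp_frame t' eta' \in unitmx.
  rewrite unitmxE unitfE; apply: det_cusp_frame => //.
  by rewrite (@shift_opp t t' eta eta') // oppr_eq0.
have D0 : diag_mx (\row_i (c' i)^-1) \in unitmx.
  rewrite unitmxE unitfE det_diag; apply/prodf_neq0 => i _.
  by rewrite mxE invr_eq0.
have uB : B \in unitmx by rewrite unitmxE unitfE.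
exists (invmx (cusp_frame t' eta') *m (diag_mx (\row_i (c' i)^-1) *m B)), c'.
split=> //.
- by rewrite !unitmx_mul unitmx_inv F0 D0 uB.
- move=> i; have -> : cusp r eta' (t' i) = row i (cusp_frame t' eta') by rewrite rowK.
  rewrite [in RHS]rowE -mulmxA mulKVmx // -rowE row_mul row_diag_mx mxE -scalemxAl -rowE.
  by rewrite scalerA divff ?scale1r.
- by move=> i; rewrite /c'; field; rewrite c0 w0.
Qed.

Section Transport.
Variables (B G G' : 'M[K]_r.+1) (t t' c c' : 'I_r.+1 -> K) (eta eta' : K).
Hypothesis lnk : cremona_link B t eta G c t' eta' G' c'.
Let S := \sum_i t i - eta.

Lemma link_scale_neq0 i : c i != 0.
Proof.
apply/eqP=> ci; have := link_scale lnk i; rewrite ci !mul0r => /esym/eqP.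
by rewrite oner_eq0.
Qed.

Lemma link_comb (a : 'I_r.+1 -> K) :
  (\sum_i a i *: cusp r eta (t i)) *m G = (\row_i (a i / c i)) *m B.
Proof.
rewrite mulmx_suml [RHS]mulmx_sum_row; apply: eq_bigr => i _.
by rewrite (link_on lnk) mxE scalerA divfK ?link_scale_neq0 // scalemxAl.
Qed.

Lemma link_coord z :
  \det B *: (z *m invmx G) =
  \sum_i (frame_coord B z 0 i * c i) *: cusp r eta (t i).
Proof.
rewrite scalemxAl -frame_coordK -[RHS](mulmxK (link_unit lnk)) link_comb.
congr (_ *m _ *m _); apply/rowP=> i.
by rewrite [RHS]mxE mulfK ?link_scale_neq0.
Qed.

End Transport.

Section Exchange.
Variables (B G G' : 'M[K]_r.+1) (t t' c c' : 'I_r.+1 -> K) (eta eta' : K).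
Hypothesis lnk : cremona_link B t eta G c t' eta' G' c'.
Let S := \sum_i t i - eta.

Let S' : \sum_i t' i - eta' = - S.
Proof. exact: (shift_opp (link_nodes lnk) (link_eta lnk)). Qed.

(** The i-th coordinates of the points of parameter [y] on the two curves have a product that does
    not depend on i. Hence they are exchanged by the transformation, and points outside the base
    keep their parameter. *)
Lemma cremona_vec_cusp y : (forall i, y != t i) -> (forall i, y != t' i) ->
  (forall i, frame_coord B (cusp r eta y *m G) 0 i != 0) /\
  proportional (cremona_vec B (cusp r eta y *m G)) (cusp r eta' y *m G').
Proof.
move=> yt yt'; have t_inj := link_inj lnk; have S0 : S != 0 := link_shift lnk.
have t'_inj := link_inj (link_sym lnk); have B0 := link_det lnk.
have w0 := node_weight_neq0 t_inj.
have c0 := link_scale_neq0 lnk; have c'0 := link_scale_neq0 (link_sym lnk).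
have p0 : \prod_l (y - t l) != 0 by apply/prodf_neq0 => l _; rewrite subr_eq0.
have p'0 : \prod_l (y - t' l) != 0 by apply/prodf_neq0 => l _; rewrite subr_eq0.
pose a : 'rV[K]_r.+1 := \row_i (((\prod_(l | l != i) (y - t l)) * (y - t i + S) /
  (node_weight t i * S)) / c i).
have aE : cusp r eta y *m G = a *m B.
  by rewrite (cusp_expansion r3 t_inj S0) (link_comb lnk).
pose a' : 'rV[K]_r.+1 := \row_i (((\prod_(l | l != i) (y - t' l)) * (y - t' i - S) /
  (node_weight t' i * - S)) / c' i).
have a'E : cusp r eta' y *m G' = a' *m B.
  have S'0 : \sum_i t' i - eta' != 0 by rewrite S' oppr_eq0.
  by rewrite (cusp_expansion r3 t'_inj S'0) (link_comb (link_sym lnk)) S'.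
have yS i : y - t i + S = y - t' i by rewrite (link_nodes lnk) -/S; ring.
have aa' i : a 0 i * a' 0 i = - (\prod_l (y - t l) * \prod_l (y - t' l)) / S ^+ 2.
  rewrite !mxE yS (node_weight_shift (link_nodes lnk)).
  have -> : y - t' i - S = y - t i by rewrite (link_nodes lnk) -/S; ring.
  have prodE u : \prod_l (y - u l) = (y - u i) * \prod_(l | l != i) (y - u l).
    by rewrite (bigD1 i).
  rewrite !prodE; set p := \prod_(l | _) (y - t l); set p' := \prod_(l | _) _.
  have -> : c' i = (c i * node_weight t i ^+ 2)^-1.
    apply: (mulIf (mulf_neq0 (c0 i) (expf_neq0 2 (w0 i)))).
    by rewrite mulVf ?mulf_neq0 ?expf_neq0 // mulrA [c' i * _]mulrC (link_scale lnk).
  by field; rewrite c0 w0 oppr_eq0 oner_eq0 S0.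
have k0 : - (\prod_l (y - t l) * \prod_l (y - t' l)) / S ^+ 2 != 0.
  by rewrite mulf_neq0 ?oppr_eq0 ?mulf_neq0 ?invr_eq0 ?expf_neq0.
have a0 i : a 0 i != 0.
  by have := k0; rewrite -(aa' i) mulf_eq0 negb_or => /andP[].
split=> [i|]; first by rewrite aE frame_coordM mxE mulf_neq0.
rewrite aE a'E; apply: proportional_trans (cremona_vecE B0 a0) _.
apply: proportional_sym; exists (- (\prod_l (y - t l) * \prod_l (y - t' l)) / S ^+ 2) => //.
rewrite scalemxAl; congr (_ *m _); apply/rowP => i.
by rewrite [RHS]mxE [X in _ * X]mxE -(aa' i) mulrAC mulfV ?mul1r.
Qed.

Lemma scrollP sigma z : scroll eta sigma (z *m invmx G) <->
  exists2 d : K * K, d != 0 & exists e, forall i,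
    frame_coord B z 0 i * c i * node_weight t i * (quad sigma d).[t i] =
    (quad (sigma + S) e).[t i].
Proof.
have B0 := link_det lnk; have t_inj := link_inj lnk.
have -> : z *m invmx G =
    \sum_i (frame_coord B z 0 i * c i / \det B) *: cusp r eta (t i).
  rewrite -[LHS](scalerK B0) (link_coord lnk) scaler_sumr.
  by apply: eq_bigr => i _; rewrite scalerA mulrC.
split=> [/(scroll_frameP r3 _ t_inj)|] [d d0 [e eE]].
  exists d => //; exists (\det B * e.1, \det B * e.2) => i.
  have := eE i; rewrite !horner_quad /= => h.
  apply: (mulfI (invr_neq0 B0)).
  transitivity (frame_coord B z 0 i * c i / \det B * node_weight t i *
    (d.1 + d.2 * (t i ^+ 2 - sigma * t i))); first by ring.
  by rewrite h /S; field.
apply/(scroll_frameP r3 _ t_inj); exists d => //.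
exists (e.1 / \det B, e.2 / \det B) => i.
have := eE i; rewrite !horner_quad /= => h.
transitivity ((e.1 + e.2 * (t i ^+ 2 - (sigma + S) * t i)) / \det B).
  by rewrite -h; ring.
by rewrite /S; ring.
Qed.

End Exchange.

Lemma quad_eq0 t sigma (d : K * K) : injective t ->
  (forall i, (quad sigma d).[t i] = 0) -> d = 0.
Proof.
move=> t_inj dt; suff d2 : d.2 = 0.
  have := dt ord0; rewrite horner_quad d2 mul0r addr0.
  by case: d d2 {dt} => d1 d2 /= -> ->.
pose k0 : 'I_r.+1 := ord0.
have [k1 k10] : exists k1 : 'I_r.+1, k1 = 1%N :> nat.
  by exists (inord 1); rewrite inordK //; lia.
have [k2 k20] : exists k2 : 'I_r.+1, k2 = 2%N :> nat.
  by exists (inord 2); rewrite inordK //; lia.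
have diff i j : i != j -> d.2 * (t i + t j - sigma) = 0.
  move=> ij; have := dt i; have := dt j; rewrite !horner_quad => hj hi.
  have tij : t i - t j != 0.
    by rewrite subr_eq0; apply: contraNneq ij => /t_inj ->.
  apply: (mulIf tij); rewrite mul0r -[RHS](subrr 0) -[X in _ = X - _]hi -hj; ring.
have h1 : d.2 * (t k0 + t k1 - sigma) = 0 by apply: diff; rewrite -val_eqE /= k10.
have h2 : d.2 * (t k0 + t k2 - sigma) = 0 by apply: diff; rewrite -val_eqE /= k20.
have t12 : t k1 - t k2 != 0.
  rewrite subr_eq0; apply/eqP => /t_inj /(congr1 val) /=; rewrite k10 k20 //.
by apply: (mulIf t12); rewrite mul0r -[RHS](subrr 0) -[X in _ = X - _]h1 -h2; ring.
Qed.

(** Inverting the coordinates exchanges the two quadratics of [scrollP]; rewriting them in the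
    shifted nodes t_i - S changes the root sum from [sigma + S] to [sigma - S]. *)
Lemma cremona_vec_scroll B t eta G c t' eta' G' c' sigma z :
  cremona_link B t eta G c t' eta' G' c' ->
  (forall i, frame_coord B z 0 i != 0) ->
  scroll eta sigma (z *m invmx G) ->
  scroll eta' (sigma - (\sum_i t i - eta)) (cremona_vec B z *m invmx G').
Proof.
move=> lnk b0 /(scrollP lnk)[d d0 [e eE]].
have t_inj := link_inj lnk; have c0 := link_scale_neq0 lnk.
have B0 := link_det lnk; have w0 := node_weight_neq0 t_inj.
set S := \sum_i t i - eta in eE *; set b := frame_coord B z in b0 eE *.
apply/(scrollP (link_sym lnk)); rewrite (shift_opp (link_nodes lnk) (link_eta lnk)).
exists (e.1 - e.2 * sigma * S, e.2).
  apply: contra_neq d0 => -[e1 e2]; apply: (quad_eq0 (sigma := sigma) t_inj) => i.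
  have := eE i; rewrite [RHS]horner_quad e2 mul0r addr0.
  move: e1; rewrite e2 !mul0r subr0 => -> /eqP.
  by rewrite !mulf_eq0 (negPf (b0 i)) (negPf (c0 i)) (negPf (w0 i)) /= => /eqP.
(* The common product of the i-th coordinate of [z] and that of its image. *)
pose kap := \det B * \prod_l b 0 l.
exists (kap * (d.1 + d.2 * (S ^+ 2 - sigma * S)), kap * d.2) => i.
rewrite (node_weight_shift (link_nodes lnk)) !horner_quad /= (link_nodes lnk) -/S.
have /= := eE i; rewrite !horner_quad => dE.
rewrite /cremona_vec frame_coordM !mxE -/b.
have -> : e.1 - e.2 * sigma * S + e.2 * ((t i - S) ^+ 2 - (sigma - S) * (t i - S)) =
  e.1 + e.2 * (t i ^+ 2 - (sigma + S) * t i) by ring.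
have -> : kap = \det B * (b 0 i * \prod_(l | l != i) b 0 l).
  by rewrite /kap (bigD1 i).
rewrite -dE; set p := \prod_(l | _) _.
have := link_scale lnk i => cE.
transitivity (\det B * p * b 0 i * (c i * c' i * node_weight t i ^+ 2) *
  (d.1 + d.2 * (t i ^+ 2 - sigma * t i))); first by ring.
by rewrite cE; ring.
Qed.

End CremonaLink.

(** * The special configuration *)

Section Frames.
Variables (r s : nat).
Hypotheses (r3 : (3 <= r)%N) (rs : (r + 5 <= s)%N).

Definition even_index (k : nat) : nat := if (k < 2)%N then k else (k + 4)%N.
Definition odd_index (k : nat) : nat := if (k < 4)%N then (k + 2)%N else (k + 4)%N.

Lemma even_index_lt (k : 'I_r.+1) : (even_index k < s)%N.
Proof. by rewrite /even_index; have := ltn_ord k; case: ifP; lia. Qed.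

Lemma odd_index_lt (k : 'I_r.+1) : (odd_index k < s)%N.
Proof. by rewrite /odd_index; have := ltn_ord k; case: ifP; lia. Qed.

Definition even_frame (k : 'I_r.+1) : 'I_s := Ordinal (even_index_lt k).
Definition odd_frame (k : 'I_r.+1) : 'I_s := Ordinal (odd_index_lt k).

(* These are the points {0,1,6,7} and {2,3,4,5}, together with the r - 3 points
   from 8 on; 0 + 1 + 6 + 7 = 2 + 3 + 4 + 5. *)
Definition level_index (j : nat) : 'I_r.+1 -> 'I_s :=
  if odd j then odd_frame else even_frame.

Lemma level_index_inj j : injective (level_index j).
Proof.
rewrite /level_index; case: odd => k k' /(congr1 val) /=.
  by rewrite /odd_index => h; apply/val_inj; move: h; do 2!case: ifP => /=; lia.
by rewrite /even_index => h; apply/val_inj; move: h; do 2!case: ifP => /=; lia.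
Qed.

Lemma level_index_mem j (k : 'I_r.+1) :
  (level_index j.+1 k \in codom (level_index j)) = (4 <= k)%N.
Proof.
apply/codomP/idP => [[k' /(congr1 val)]|k4].
  rewrite /level_index /=; case: odd => /=; rewrite /even_index /odd_index;
    by do 2!case: ifP => /=; lia.
exists k; apply/val_inj; rewrite /level_index /=.
by case: odd; rewrite /= /even_index /odd_index; do 2!case: ifP => /=; lia.
Qed.

Lemma sum_level_index j :
  \sum_k (level_index j k : nat)%:Z = \sum_k (level_index 0 k : nat)%:Z :> int.
Proof.
rewrite /level_index /=; case: odd => //=.
rewrite -(big_mkord xpredT (fun k => (odd_index k)%:Z)).
rewrite -(big_mkord xpredT (fun k => (even_index k)%:Z)).
rewrite (@big_cat_nat _ _ _ 4) // [RHS](@big_cat_nat _ _ _ 4) //=.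
congr (_ + _); first by rewrite !big_nat_recl // !big_geq.
apply: eq_big_nat => k; rewrite /even_index /odd_index.
by do 2!case: ifP => /=; lia.
Qed.

Lemma card_level_index_mem j :
  \sum_k (level_index j.+1 k \in codom (level_index j) : nat)%:Z = r%:Z - 3 :> int.
Proof.
under eq_bigr => k _ do rewrite level_index_mem.
rewrite -(big_mkord xpredT (fun k => ((4 <= k)%N : nat)%:Z)).
rewrite (@big_cat_nat _ _ _ 4) //= [X in X + _](_ : _ = 0) ?add0r; last first.
  by rewrite !big_nat_recl // big_geq.
rewrite (eq_big_nat _ _ (F2 := fun=> 1%:Z)) => [|k /andP[-> _] //].
by rewrite big_const_nat iter_addr_0 natz; lia.
Qed.

(** The total displacement of a parameter in units of 2s; the weights 2 kappa' + 1 match [drift]. *)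
Fixpoint moves (kappa : nat) (i : 'I_s) : nat :=
  if kappa is kappa'.+1 then
    (moves kappa' i + (i \in codom (level_index kappa)) * (2 * kappa' + 1))%N
  else 0%N.

(* Parameters on the cuspidal curve of the points of the witness, which has
   undergone [kappa] Cremona transformations; the frame of step [kappa] is
   [level_index kappa.+1]. All differences of labels stay nonzero modulo [2 s]. *)
Definition node (kappa : nat) (i : 'I_s) : int :=
  (i : nat)%:Z - 2 * s%:Z * (moves kappa i)%:Z.

Definition drift (kappa : nat) : int := 2 * s%:Z * (2 * kappa%:Z + 1).

(** The constant [eta] of the curve at time [kappa]. The initial value makes the first shift equal
    to 2s. *)
Fixpoint node_sum (kappa : nat) : int :=
  if kappa is kappa'.+1 then node_sum kappa' - (r%:Z - 1) * drift kappa'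
  else \sum_k (level_index 0 k : nat)%:Z - 2 * s%:Z.

Lemma nodeS kappa i : node kappa.+1 i =
  node kappa i - (i \in codom (level_index kappa.+1) : nat)%:Z * drift kappa.
Proof. by rewrite /node /drift /=; lia. Qed.

(** Consecutive frames share r - 3 points, so a step adds (r - 1) - (r - 3) = 2 drifts to the shift
    at the other frame. This is the parabolic recursion again, and the shifts grow linearly. *)
Lemma sum_node kappa :
  \sum_k node kappa (level_index kappa.+1 k) - node_sum kappa = drift kappa /\
  \sum_k node kappa (level_index kappa k) - node_sum kappa =
    - (2 * s%:Z * (2 * kappa%:Z - 1)).
Proof.
elim: kappa => [|kappa [IH1 IH2]].
  have E j : \sum_k node 0 (level_index j k) = \sum_k (level_index 0 k : nat)%:Z.
    by rewrite -(sum_level_index j); apply: eq_bigr => k _; rewrite /node /=; lia.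
  by rewrite !E /= /drift; lia.
have F2 : level_index kappa.+2 = level_index kappa by rewrite /level_index /= negbK.
split.
  have -> : \sum_k node kappa.+1 (level_index kappa.+2 k) =
      \sum_k node kappa (level_index kappa k) - (r%:Z - 3) * drift kappa.
    rewrite -(card_level_index_mem kappa.+1) mulr_suml -sumrB F2.
    by apply: eq_bigr => k _; rewrite nodeS.
  by move: IH2; rewrite /= /drift; nia.
have -> : \sum_k node kappa.+1 (level_index kappa.+1 k) =
    \sum_k node kappa (level_index kappa.+1 k) - (r%:Z + 1) * drift kappa.
  have -> : r%:Z + 1 = \sum_(k < r.+1) 1 by rewrite sumr_const card_ord natz; lia.
  rewrite mulr_suml -sumrB; apply: eq_bigr => k _.
  by rewrite nodeS codom_f.
by move: IH1; rewrite /= /drift; nia.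
Qed.

(** A parameter is congruent to its label modulo 2s, and labels are less than s. *)
Lemma node_neq kappa kappa' i j : i != j -> node kappa i != node kappa' j.
Proof.
move=> ij; apply/eqP => h; case/eqP: ij; apply/val_inj => /=.
have := ltn_ord i; have := ltn_ord j; move: h; rewrite /node.
move: (nat_of_ord i) (nat_of_ord j) (moves _ _) (moves _ _) => a b e e' h bs as_.
have [ee|ee] := eqVneq e e'; first by subst e'; lia.
by have [ee'|ee'] := leqP e e'; nia.
Qed.

Lemma moves_le kappa kappa' i : (kappa' <= kappa)%N -> (moves kappa' i <= moves kappa i)%N.
Proof.
move/subnK <-; elim: (kappa - kappa')%N => [|d IH] //=.
by rewrite (leq_trans IH) // leq_addr.
Qed.

Lemma node_moved kappa kappa' i : (kappa' <= kappa)%N ->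
  i \in codom (level_index kappa.+1) -> node kappa.+1 i != node kappa' i.
Proof.
move=> /(moves_le i) le iF; apply/eqP; rewrite /node [moves kappa.+1 i]/= iF mul1n.
by have := ltn_ord i; nia.
Qed.

(* The parameter sum of the end points of the secants that sweep out the scroll. *)
Fixpoint secant_sum (kappa0 k : nat) : int :=
  if k is k'.+1 then secant_sum kappa0 k' - drift (kappa0 + k')
  else node kappa0 (level_index 0 ord0) + node kappa0 (level_index 0 (inord 1)).

Let line0 : 'I_s := level_index 0 ord0.
Let line1 : 'I_s := level_index 0 (inord 1).

Let line1E : nat_of_ord line1 = 1%N.
Proof. by rewrite /= /even_index inordK //; lia. Qed.

Let line_mem j (i : 'I_s) : (i <= 1)%N -> (i \in codom (level_index j)) = ~~ odd j.
Proof.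
move=> i1; apply/codomP/idP => [[k /(congr1 val)]|].
  rewrite /level_index; case: odd => //=.
  by rewrite /odd_index; case: ifP; lia.
rewrite /level_index; case: odd => // _; exists (inord i); apply/val_inj.
by rewrite /= /even_index inordK; [case: ifP|]; lia.
Qed.

(** The points 0 and 1 move only at every second step, by one drift each, while the secant sum drops
    by one drift at every step; the last term records the difference. *)
Lemma secant_sumE kappa0 k : ~~ odd kappa0 ->
  secant_sum kappa0 k = node (kappa0 + k) line0 + node (kappa0 + k) line1 +
  (if odd k then - (2 * s%:Z * (2 * kappa0%:Z + k%:Z)) else 2 * s%:Z * k%:Z).
Proof.
move=> even0; elim: k => [|k IH]; first by rewrite addn0 /= -/line0 -/line1; lia.
rewrite addnS !nodeS /= !line_mem ?line1E //= IH oddD (negbTE even0) /= negbK /drift.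
by case: (odd k) => /=; nia.
Qed.

(** Modulo 2s the secant sum is 0 + 1 = 1, which the labels of two distinct points match only for
    the pair {0, 1}; for that pair the size of the difference decides. *)
Lemma secant_sum_neq kappa0 k i j : ~~ odd kappa0 -> i != j ->
  i \in codom (level_index (kappa0 + k).+1) ->
  j \in codom (level_index (kappa0 + k).+1) ->
  secant_sum kappa0 k != node (kappa0 + k) i + node (kappa0 + k) j /\
  secant_sum kappa0 k - (node (kappa0 + k) i - drift (kappa0 + k)) !=
    node (kappa0 + k) j.
Proof.
move=> even0 ij iF jF; rewrite (secant_sumE _ even0).
have oddE : odd (kappa0 + k) = odd k by rewrite oddD (negbTE even0).
have ijs : (i + j < 2 * s)%N by have := ltn_ord i; have := ltn_ord j; lia.
have ijN : nat_of_ord i != nat_of_ord j by [].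
have ij0 : (0 < i + j)%N by lia.
have [[i1 j1]|ij1] : ((i <= 1)%N /\ (j <= 1)%N) \/ (2 <= i + j)%N by lia.
  move: iF; rewrite line_mem //= negbK oddE => ok; rewrite ok.
  have sumE : node (kappa0 + k) line0 + node (kappa0 + k) line1 =
      node (kappa0 + k) i + node (kappa0 + k) j.
    have line0P (x : 'I_s) : nat_of_ord x = 0%N -> x = line0 by move=> h; apply/val_inj.
    have line1P (x : 'I_s) : nat_of_ord x = 1%N -> x = line1.
      by move=> h; apply/val_inj; rewrite [RHS]line1E.
    have [[i0 j0]|[i0 j0]] : (nat_of_ord i = 0%N /\ nat_of_ord j = 1%N) \/
        (nat_of_ord i = 1%N /\ nat_of_ord j = 0%N) by lia.
      by rewrite (line0P i) // (line1P j).
    by rewrite (line1P i) // (line0P j) // addrC.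
  rewrite sumE /drift; split; apply/eqP; first by nia.
  by rewrite PoszD; nia.
have [x xE] : exists x : int, node (kappa0 + k) line0 + node (kappa0 + k) line1 +
    (if odd k then - (2 * s%:Z * (2 * kappa0%:Z + k%:Z)) else 2 * s%:Z * k%:Z) =
    1 + 2 * s%:Z * x.
  exists (- (moves (kappa0 + k) line0)%:Z - (moves (kappa0 + k) line1)%:Z +
    (if odd k then - (2 * kappa0%:Z + k%:Z) else k%:Z)).
  by rewrite /node line1E (_ : nat_of_ord line0 = 0%N) //; case: odd; ring.
rewrite xE /node /drift; move: (moves _ i) (moves _ j) => e e'.
have sep (y : int) : (i + j)%N%:Z != 1 + 2 * s%:Z * y.
  apply/eqP => h; have [y0|y0] := leP y 0; first by nia.
  by nia.
split; apply/eqP => h.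
  by have /eqP := sep (x + e%:Z + e'%:Z); apply; lia.
by have /eqP := sep (x + e%:Z + e'%:Z + 2 * (kappa0 + k)%N%:Z + 1); apply; lia.
Qed.

End Frames.

Lemma exists_nonroot (K : numFieldType) (p : {poly K}) : p != 0 -> exists x, p.[x] != 0.
Proof.
move=> p0; apply/not_existsP => root_p; case/eqP: p0.
apply: (@roots_geq_poly_eq0 _ _ [seq n%:R | n <- iota 0 (size p)]).
- by apply/allP => _ /mapP[n _ ->]; apply/negPn/negP/root_p.
- by rewrite map_inj_uniq ?iota_uniq // => m n /eqP; rewrite eqr_nat => /eqP.
- by rewrite size_map size_iota.
Qed.

Lemma exists_root_seq (K : fieldType) (p : {poly K}) : p != 0 ->
  exists rs : seq K, forall x, p.[x] = 0 -> x \in rs.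
Proof.
elim: {p}(size p) {-2}p (leqnn (size p)) => [|n IH] p sp p0.
  by move: p0; rewrite -size_poly_eq0 -leqn0 sp.
have [[x /rootP/factor_theorem[q pE]]|noroot] := pselect (exists x, p.[x] = 0).
  have q0 : q != 0 by apply: contra_neq p0 => q0; rewrite pE q0 mul0r.
  have [|rs rsP] := IH q _ q0.
    by move: sp; rewrite pE size_Mmonic ?monicXsubC // size_XsubC addn2.
  exists (x :: rs) => y; rewrite pE hornerM hornerXsubC inE => /eqP.
  rewrite mulf_eq0 subr_eq0 orbC => /orP[->//|/eqP/rsP ->]; exact: orbT.
by exists [::] => x px; case: noroot; exists x.
Qed.

(** Each [y] accounts for at most one good element; this will bound the parameters whose image lies
    in a finite list of points. *)
Lemma finite_fibers (A B : eqType) (good : A -> Prop) (P : A -> B -> Prop) (Y : seq B) :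
  (forall w w' y, good w -> good w' -> P w y -> P w' y -> w = w') ->
  (forall w, good w -> exists2 y, y \in Y & P w y) ->
  exists ws : seq A, forall w, good w -> w \in ws.
Proof.
elim: Y good => [|y Y IH] good P_inj goodY; first by exists [::] => w /goodY[].
have [|w gw|ws wsP] := IH (fun w => good w /\ ~ P w y).
- by move=> w w' y' [gw _] [gw' _]; exact: P_inj.
- have [y'] := goodY w gw.1; rewrite inE => /orP[/eqP -> /gw.2//|y'Y Pw].
  by exists y'.
have [[w0 [gw0 Pw0]]|none] := pselect (exists w0, good w0 /\ P w0 y).
  exists (w0 :: ws) => w gw; rewrite inE; have [Pw|nPw] := pselect (P w y).
    by rewrite (P_inj _ _ _ gw gw0 Pw Pw0) eqxx.
  by rewrite wsP ?orbT.
by exists ws => w gw; apply: wsP; split=> // Pw; apply: none; exists w.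
Qed.

(** * Hyperplane sections of the scroll *)

Section HyperplaneSection.
Variables (K : fieldType) (r : nat) (r3 : (3 <= r)%N).
Variables (B G G' : 'M[K]_r.+1) (t t' c c' : 'I_r.+1 -> K) (eta eta' sigma : K).
Hypothesis lnk : cremona_link B t eta G c t' eta' G' c'.
Variable i : 'I_r.+1.

Let S := \sum_k t k - eta.
Let x0 := t i - S.
Let x1 := sigma - x0.
Hypothesis sigma_sum : forall k k', k != k' -> sigma != t k + t k'.
Hypothesis x1_node : forall k, k != i -> x1 != t k.

Let numer k := (t k - t i) * (t k - x1) / (c k * node_weight t k).
Let denom (p : K) k := p + t k ^+ 2 - sigma * t k.

(* The section of the scroll by the hyperplane spanned by the rows [k != i] of
   [B] is the rational curve parametrized by [section_curve]. *)
Definition section_curve (p : K) : 'rV[K]_r.+1 :=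
  (\row_k (numer k * \prod_(l | (l != i) && (l != k)) denom p l)) *m B.

Definition section_end : 'rV[K]_r.+1 := (\row_k numer k) *m B.

Let numer_i : numer i = 0.
Proof. by rewrite /numer subrr !mul0r. Qed.

Let w0 k : node_weight t k != 0.
Proof. exact: node_weight_neq0 (link_inj lnk) k. Qed.

Let c0 k : c k != 0.
Proof. exact: link_scale_neq0 lnk k. Qed.

Lemma coord_proportional z (a : 'rV_r.+1) (k : K) : k != 0 ->
  frame_coord B z = k *: a -> proportional z (a *m B).
Proof.
move=> k0 zE; have B0 := link_det lnk; exists (k / \det B).
  by rewrite mulf_neq0 ?invr_eq0.
by rewrite mulrC -scalerA scalemxAl -zE frame_coordK scalerA mulVf ?scale1r.
Qed.

(** The vanishing of the i-th coordinate makes t_i a root of the second quadratic, so its other root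
    is [x1]. The three cases are: this quadratic vanishes, the first quadratic is constant (the
    limit of the parameter at infinity), and the general case. *)
Lemma hyperplane_section z : z != 0 -> scroll eta sigma (z *m invmx G) ->
  frame_coord B z 0 i = 0 ->
  [\/ exists k, proportional z (row k B), proportional z section_end |
      exists p, proportional z (section_curve p)].
Proof.
move=> z0 /(scrollP r3 lnk)[d d0 [e eE]] zi; set b := frame_coord B z in zi eE *.
have B0 := link_det lnk; have t_inj := link_inj lnk.
have e1 : e.1 = - e.2 * (t i ^+ 2 - (sigma + S) * t i).
  have := eE i; rewrite zi !mul0r horner_quad => /esym/eqP.
  by rewrite addr_eq0 => /eqP ->; rewrite mulNr.
have {}eE k : b 0 k * c k * node_weight t k * (quad sigma d).[t k] =
    e.2 * ((t k - t i) * (t k - x1)).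
  by rewrite eE horner_quad e1 /x1 /x0 /S; ring.
have [e2|e2] := eqVneq e.2 0.
  apply: Or31.
  have [k bk] : exists k, b 0 k != 0.
    apply/not_existsP => b0; case/eqP: z0; apply: (scalerI B0).
    rewrite scaler0 -frame_coordK -/b (_ : b = 0) ?mul0mx //.
    by apply/rowP=> k; rewrite [RHS]mxE; apply/eqP/negPn/negP/b0.
  (* Two nonzero coordinates would yield two nodes of sum [sigma], so only one coordinate survives
     and [z] is a frame point. *)
  have dk l : b 0 l != 0 -> (quad sigma d).[t l] = 0.
    move=> bl; have := eE l; rewrite e2 mul0r => /eqP.
    by rewrite !mulf_eq0 (negPf bl) (negPf (c0 l)) (negPf (w0 l)) => /eqP.
  exists k; rewrite rowE; apply: (@coord_proportional _ _ (b 0 k)) => //.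
  apply/rowP=> l; rewrite [RHS]mxE [X in _ * X]mxE eqxx -/b /=.
  have [->|lk] := eqVneq l k; first by rewrite mulr1.
  rewrite mulr0; apply/eqP/negPn/negP => bl.
  have := dk l bl; have := dk k bk; rewrite !horner_quad => hk hl.
  have d2 : d.2 != 0.
    apply: contra_neq d0 => d2; move: hk; rewrite d2 mul0r addr0.
    by case: d d2 {eE dk hl} => d1 d2' /= -> ->.
  have kl : t k - t l != 0.
    by rewrite subr_eq0; apply: contraNneq lk => /t_inj ->.
  have : d.2 * ((t k - t l) * (t k + t l - sigma)) = 0.
    by rewrite -[RHS](subrr 0) -[X in _ = X - _]hk -hl; ring.
  move/eqP; rewrite !mulf_eq0 (negPf d2) (negPf kl) /= subr_eq0 eq_sym.
  by rewrite (negPf (sigma_sum _)) // eq_sym.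
have [d2|d2] := eqVneq d.2 0.
  apply: Or32; have d1 : d.1 != 0.
    by apply: contra_neq d0 => d1; case: d d1 d2 {eE} => ? ? /= -> ->.
  apply: (@coord_proportional _ _ (e.2 / d.1)); first by rewrite mulf_neq0 ?invr_eq0.
  apply/rowP=> k; rewrite [RHS]mxE [X in _ * X]mxE /numer -/b.
  have := eE k; rewrite horner_quad d2 mul0r addr0 => h.
  apply: (mulIf d1); apply: (mulIf (w0 k)); apply: (mulIf (c0 k)).
  transitivity (b 0 k * c k * node_weight t k * d.1); first by ring.
  by rewrite h; field; rewrite d1 c0 w0.
apply: Or33; exists (d.1 / d.2); set p := d.1 / d.2.
have {}eE k : b 0 k * c k * node_weight t k * (d.2 * denom p k) =
    e.2 * ((t k - t i) * (t k - x1)).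
  by rewrite -eE horner_quad /denom /p; field.
have denom0 k : k != i -> denom p k != 0.
  move=> ki; apply/eqP => pk; have := eE k; rewrite pk !mulr0 => /esym/eqP.
  rewrite !mulf_eq0 (negPf e2) !subr_eq0 /= => /orP[/eqP/t_inj/eqP|/eqP tx].
    by rewrite (negPf ki).
  by have := x1_node ki; rewrite tx eqxx.
have P0 : \prod_(l | l != i) denom p l != 0 by apply/prodf_neq0.
apply: (@coord_proportional _ _ (e.2 / (d.2 * \prod_(l | l != i) denom p l))).
  by rewrite mulf_neq0 ?invr_eq0 ?mulf_neq0.
apply/rowP=> k; rewrite [RHS]mxE [X in _ * X]mxE -/b.
have [->|ki] := eqVneq k i; first by rewrite zi numer_i mul0r mulr0.
rewrite (bigD1 k ki) /=; set q := \prod_(l | _) _.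
have q0 : q != 0 by apply/prodf_neq0 => l /andP[li _]; exact: denom0.
have pk := denom0 k ki; have := eE k => h.
apply: (mulIf (mulf_neq0 d2 pk)); apply: (mulIf (w0 k)); apply: (mulIf (c0 k)).
transitivity (b 0 k * c k * node_weight t k * (d.2 * denom p k)); first by ring.
by rewrite h /numer; field; rewrite q0 pk d2 c0 w0.
Qed.

(** At this parameter the secant is the one through the parameters [x0] and [x1], and it meets the
    hyperplane in the residual point of the cuspidal curve. *)
Lemma section_curve_cusp : (forall k, x0 != t k) ->
  proportional (section_curve (x0 * x1)) (cusp r eta x0 *m G).
Proof.
move=> x0_node; have B0 := link_det lnk; have t_inj := link_inj lnk.
have S0 : S != 0 := link_shift lnk.
rewrite (cusp_expansion r3 t_inj S0) (link_comb lnk).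
have denomE k : denom (x0 * x1) k = (t k - x0) * (t k - x1).
  by rewrite /denom /x1; ring.
have denom0 k : k != i -> denom (x0 * x1) k != 0.
  move=> ki; rewrite denomE mulf_neq0 // subr_eq0 eq_sym //; exact: x1_node.
have P0 : \prod_(l | l != i) denom (x0 * x1) l != 0 by apply/prodf_neq0.
have X0 : \prod_l (x0 - t l) != 0 by apply/prodf_neq0 => l _; rewrite subr_eq0.
exists ((\prod_(l | l != i) denom (x0 * x1) l) * S / \prod_l (x0 - t l)).
  by rewrite !mulf_neq0 ?invr_eq0.
rewrite /section_curve scalemxAl; congr (_ *m _); apply/rowP=> k.
rewrite [LHS]mxE [RHS]mxE [X in _ = _ * X]mxE.
have [->|ki] := eqVneq k i.
  by rewrite numer_i mul0r [x0 - t i + S](_ : _ = 0) ?mulr0 ?mul0r ?mulr0 // /x0; ring.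
rewrite (bigD1 k ki) /= [X in _ / X](bigD1 k) //= denomE.
have Xk : \prod_(l | l != k) (x0 - t l) != 0.
  by apply/prodf_neq0 => l _; rewrite subr_eq0.
have tx0 : t k - x0 != 0 by rewrite subr_eq0 eq_sym.
have tx1 : t k - x1 != 0 by rewrite subr_eq0 eq_sym x1_node.
have x0t : x0 - t k != 0 by rewrite subr_eq0.
have -> : x0 - t k + S = t i - t k by rewrite /x0; ring.
rewrite /numer -/S; set q := \prod_(l | _ && _) _.
by field; rewrite ?Xk ?x0t ?S0 ?c0 ?w0.
Qed.

End HyperplaneSection.

(** Base points and other points land on one common cuspidal curve: the former with parameters
    shifted by S, the latter with parameters kept. *)
Lemma cusp_step (K : fieldType) (r s : nat) (phi : 'I_r.+1 -> 'I_s)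
    (A : 'M[K]_(s, r.+1)) (t : 'I_s -> K) (eta : K) (G : 'M[K]_r.+1) (c : 'I_s -> K) :
  (3 <= r)%N -> injective phi ->
  (forall i, row i A = c i *: (cusp r eta (t i) *m G)) -> (forall i, c i != 0) ->
  G \in unitmx -> injective (t \o phi) ->
  let S := \sum_k t (phi k) - eta in S != 0 ->
  (forall i, i \notin codom phi -> forall k, t i != t (phi k) /\ t i != t (phi k) - S) ->
  framed phi A /\ exists G' c', [/\ G' \in unitmx, forall i, c' i != 0,
    forall i, row i (cremona_step phi A) = c' i *: (cusp r (eta - (r%:R - 1) * S)
      (if i \in codom phi then t i - S else t i) *m G') &
    cremona_link (frame phi A) (t \o phi) eta G (c \o phi)
      (fun k => t (phi k) - S) (eta - (r%:R - 1) * S) G' (c' \o phi)].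
Proof.
move=> r3 phi_inj rowA c0 uG t_inj S S0 tN.
have onA : on_cusp (frame phi A) (t \o phi) eta G (c \o phi).
  by move=> k; rewrite row_frame rowA.
have [G' [b lnk]] := exists_link t_inj S0 uG (fun k => c0 (phi k)) onA.
have moved i : i \notin codom phi ->
    (forall k, frame_coord (frame phi A) (row i A) 0 k != 0) /\
    proportional (cremona_vec (frame phi A) (row i A))
      (cusp r (eta - (r%:R - 1) * S) (t i) *m G').
  move=> iN; have [coord0 prop] := cremona_vec_cusp r3 lnk (fun k => (tN i iN k).1)
    (fun k => (tN i iN k).2).
  split=> [k|]; first by rewrite rowA frame_coordZ mxE mulf_neq0.
  apply: proportional_trans prop; apply: cremona_vec_proportional.
  by rewrite rowA; exact: proportionalZ.
split; first by split=> [|i /moved[]//]; exact: link_det lnk.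
have /boolp.choice[c' c'P] : forall i, exists x, [/\ x != 0,
    row i (cremona_step phi A) = x *: (cusp r (eta - (r%:R - 1) * S)
      (if i \in codom phi then t i - S else t i) *m G') &
    forall k, i = phi k -> x = b k].
  move=> i; have [iF|iN] := boolP (i \in codom phi); last first.
    have [_ [x x0 xE]] := moved i iN; exists x; split=> //.
      by rewrite row_cremona_step (negPf iN).
    by move=> k ik; rewrite ik codom_f in iN.
  have [k ik] := codomP iF; exists (b k); split.
  - exact: (link_scale_neq0 (link_sym lnk)).
  - by rewrite row_cremona_step iF ik -row_frame (link_on' lnk).
  - by move=> k'; rewrite ik => /phi_inj ->.
exists G', c'; split.
- exact: link_unit' lnk.
- by move=> i; have [] := c'P i.
- by move=> i; have [] := c'P i.
- rewrite (_ : c' \o phi = b) //; apply: funext => k /=.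
  by have [_ _] := c'P (phi k); apply.
Qed.

(** * Following the line through the levels of the cuspidal configuration *)

Section CuspidalWitness.
Variables (K : numFieldType) (r s : nat) (r3 : (3 <= r)%N) (rs : (r + 5 <= s)%N).

Let L := level_index r3 rs.
Let T kappa i : K := (node r3 rs kappa i)%:~R.
Let Eta kappa : K := (node_sum r3 rs kappa)%:~R.
Let Dr kappa : K := (drift s kappa)%:~R.

Let Dr_neq0 kappa : Dr kappa != 0.
Proof. by rewrite intr_eq0 /drift; apply/eqP; nia. Qed.

Let T_shift kappa i : T kappa.+1 i =
  if i \in codom (L kappa.+1) then T kappa i - Dr kappa else T kappa i.
Proof.
rewrite /T nodeS rmorphB rmorphM /=; case: (i \in _); rewrite ?mul1r //.
by rewrite mul0r subr0.
Qed.

Let Eta_shift kappa : Eta kappa.+1 = Eta kappa - (r%:R - 1) * Dr kappa.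
Proof. by rewrite /Eta /= rmorphB rmorphM rmorphB. Qed.

Let T_sum kappa : \sum_k T kappa (L kappa.+1 k) - Eta kappa = Dr kappa.
Proof. by rewrite -rmorph_sum -rmorphB /= (sum_node r3 rs kappa).1. Qed.

Let T_sum_moved kappa :
  \sum_k T kappa.+1 (L kappa.+1 k) - Eta kappa.+1 = - Dr kappa.
Proof.
rewrite -rmorph_sum -rmorphB /= (sum_node r3 rs kappa.+1).2 /Dr -rmorphN /drift.
by congr (_%:~R); lia.
Qed.

Let T_neq kappa kappa' i j : i != j -> T kappa i != T kappa' j.
Proof. by move=> ij; rewrite eqr_int node_neq. Qed.

Let T_moved kappa kappa' i : (kappa' <= kappa)%N -> i \in codom (L kappa.+1) ->
  T kappa.+1 i != T kappa' i.
Proof. by move=> le iF; rewrite eqr_int node_moved. Qed.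

Variable N : nat.
Hypothesis N_even : ~~ odd N.

Let L_time j : (j < N)%N -> L j = L (N - j.+1).+1.
Proof.
move=> jN; rewrite /L /level_index -subSn // subSS oddB ?(ltnW jN) //.
by rewrite (negPf N_even).
Qed.

(** Level j carries the parameters of time [N - j]. Descending from level l to level 0 therefore
    runs the time forwards from [N - l] to [N]. *)
Let M : 'M[K]_(s, r.+1) := \matrix_(i < s) cusp r (Eta N) (T N i).

Lemma exists_cusp_levels : exists (G : nat -> 'M[K]_r.+1) (c : nat -> 'I_s -> K),
  (forall j, (j <= N)%N -> [/\ G j \in unitmx, forall i, c j i != 0 &
     forall i, row i (level L M j) = c j i *: (cusp r (Eta (N - j)) (T (N - j) i) *m G j)]) /\
  (forall j, (j < N)%N -> framed (L j) (level L M j) /\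
     cremona_link (level_frame L M j) (T (N - j) \o L j) (Eta (N - j)) (G j) (c j \o L j)
       (T (N - j.+1) \o L j) (Eta (N - j.+1)) (G j.+1) (c j.+1 \o L j)).
Proof.
pose good j (x : 'M[K]_r.+1 * ('I_s -> K)) := [/\ x.1 \in unitmx,
  forall i, x.2 i != 0 & forall i, row i (level L M j) =
    x.2 i *: (cusp r (Eta (N - j)) (T (N - j) i) *m x.1)].
pose linked j (x y : 'M[K]_r.+1 * ('I_s -> K)) := framed (L j) (level L M j) /\
  cremona_link (level_frame L M j) (T (N - j) \o L j) (Eta (N - j)) x.1 (x.2 \o L j)
       (T (N - j.+1) \o L j) (Eta (N - j.+1)) y.1 (y.2 \o L j).
have /boolp.choice[F FP] : forall jx, exists y, good jx.1 jx.2 -> (jx.1 < N)%N ->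
    good jx.1.+1 y /\ linked jx.1 jx.2 y.
  case=> j [G c] /=; have [[]|gN] := pselect (good j (G, c)); last by exists (G, c).
  move=> /= uG c0 rowj; have [jN|jN] := ltnP j N; last by exists (G, c).
  have kE : (N - j = (N - j.+1).+1)%N by lia.
  set kappa := (N - j.+1)%N in kE *.
  have LE : L j = L kappa.+1 by exact: L_time.
  have t_inj : injective (T (N - j) \o L j).
    move=> k k' /= /eqP; apply: contraTeq => kk; apply: T_neq.
    by apply: contraNneq kk => /(level_index_inj (r3 := r3)) ->.
  have SE : \sum_k T (N - j) (L j k) - Eta (N - j) = - Dr kappa.
    by rewrite kE LE T_sum_moved.
  have S0 : \sum_k T (N - j) (L j k) - Eta (N - j) != 0.
    by rewrite SE oppr_eq0 Dr_neq0.
  have back i : i \in codom (L j) -> T (N - j) i + Dr kappa = T kappa i.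
    by move=> iF; rewrite kE T_shift -LE iF subrK.
  have [|fr [G' [c' [uG' c'0 row' lnk]]]] :=
      cusp_step r3 (@level_index_inj r s r3 rs j) rowj c0 uG t_inj S0.
    move=> i iN k; have ik : i != L j k.
      by apply: contraNneq iN => ->; exact: codom_f.
    split; first exact: T_neq.
    by rewrite SE opprK back ?codom_f //; exact: T_neq.
  have etaE : Eta (N - j) - (r%:R - 1) * (\sum_k T (N - j) (L j k) - Eta (N - j)) = Eta kappa.
    by rewrite SE kE Eta_shift; ring.
  rewrite etaE in row' lnk; exists (G', c') => _ _; split; first split=> //= i.
    rewrite row' SE opprK; congr (_ *: (cusp _ _ _ *m _)).
    by case: ifP => [/back //|iN]; rewrite kE T_shift -LE iN.
  split=> //=; move: lnk; rewrite SE.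
  rewrite (_ : (fun k => T (N - j) (L j k) - - Dr kappa) = T kappa \o L j) //.
  by apply: funext => k; rewrite opprK back ?codom_f.
pose st := fix st j := if j is j'.+1 then F (j', st j') else (1%:M, fun=> 1).
have stP j : (j <= N)%N -> good j (st j).
  elim: j => [_|j IH jN]; last by have [] := FP (j, st j) (IH (ltnW jN)) jN.
  split=> [|i|i] /=; first exact: unitmx1.
    exact: oner_neq0.
  by rewrite rowK scale1r mulmx1 subn0.
exists (fun j => (st j).1), (fun j => (st j).2); split=> [|j jN]; first exact: stP.
by have [] := FP (j, st j) (stP j (ltnW jN)) jN.
Qed.


Section Path.
Variables (G : nat -> 'M[K]_r.+1) (c : nat -> 'I_s -> K).
Hypothesis levelG : forall j, (j <= N)%N -> [/\ G j \in unitmx, forall i, c j i != 0 &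
  forall i, row i (level L M j) = c j i *: (cusp r (Eta (N - j)) (T (N - j) i) *m G j)].
Hypothesis linkG : forall j, (j < N)%N -> framed (L j) (level L M j) /\
  cremona_link (level_frame L M j) (T (N - j) \o L j) (Eta (N - j)) (G j) (c j \o L j)
    (T (N - j.+1) \o L j) (Eta (N - j.+1)) (G j.+1) (c j.+1 \o L j).

Variable l : nat.
Hypotheses (lN : (l < N)%N) (l_even : ~~ odd l).
Let k0 : 'I_r.+1 := ord0.
Let k1 : 'I_r.+1 := inord 1.
Let k2 : 'I_r.+1 := inord 2.
Let z k w := descend L (L l k0) (L l k1) M w l k.
Let path k w := descends L (L l k0) (L l k1) M w l k.
Let kappa0 := (N - l)%N.
Let sigma k : K := (secant_sum r3 rs kappa0 k)%:~R.

Let kappa0_even : ~~ odd kappa0.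
Proof. by rewrite /kappa0 oddB ?(ltnW lN) // (negPf N_even) (negPf l_even). Qed.

Let L_l : L l = L 0.
Proof. by rewrite /L /level_index (negPf l_even). Qed.

Let k01 : k0 != k1.
Proof. by rewrite -val_eqE /= inordK //; lia. Qed.

Let k02 : k0 != k2.
Proof. by rewrite -val_eqE /= inordK //; lia. Qed.

Let k12 : k1 != k2.
Proof. by rewrite -val_eqE /= !inordK //; lia. Qed.

Let time k : (k <= l)%N -> (N - (l - k) = kappa0 + k)%N.
Proof. by rewrite /kappa0; lia. Qed.

Let link_down k : (k < l)%N ->
  cremona_link (level_frame L M (l - k.+1))
    (T (kappa0 + k) \o L (l - k.+1)) (Eta (kappa0 + k)) (G (l - k)) (c (l - k) \o L (l - k.+1))
    (T (kappa0 + k).+1 \o L (l - k.+1)) (Eta (kappa0 + k).+1) (G (l - k.+1))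
    (c (l - k.+1) \o L (l - k.+1)).
Proof.
move=> kl; have [|_ /link_sym] := @linkG (l - k.+1)%N; first by lia.
have -> : (l - k.+1).+1 = (l - k)%N by lia.
by rewrite !time ?(ltnW kl) // addnS.
Qed.

Let L_down k : (k < l)%N -> L (l - k.+1) = L (kappa0 + k).+1.
Proof.
move=> kl; rewrite L_time; last by lia.
by congr (L _.+1); rewrite /kappa0; lia.
Qed.

Let S_down k : (k < l)%N ->
  \sum_i (T (kappa0 + k) \o L (l - k.+1)) i - Eta (kappa0 + k) = Dr (kappa0 + k).
Proof. by move=> kl; rewrite L_down // -T_sum. Qed.

Lemma descend_scroll k w : (k <= l)%N -> path k w ->
  scroll (Eta (kappa0 + k)) (sigma k) (z k w *m invmx (G (l - k))).
Proof.
elim: k => [_ _|k IH kl pk].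
  have [uG _ rowl] := levelG (ltnW lN).
  rewrite subn0 addn0 /z /= !rowl scalerA mulmxDl -!scalemxAl !mulmxK //.
  rewrite /sigma /= rmorphD /= L_l; exact: secant_scroll.
have := cremona_vec_scroll r3 (link_down kl) (pk k (ltnSn k))
  (IH (ltnW kl) (fun k' h => pk k' (ltnW h))).
by rewrite S_down // /sigma /= rmorphB addnS.
Qed.

(** A point of the cuspidal curve keeps its parameter while climbing, provided that it never meets a
    node on the way. *)
Lemma ascend_cusp j k y : (j + k <= N)%N ->
  (forall kappa i, (N - (j + k) <= kappa <= N - j)%N -> y != T kappa i) ->
  proportional (ascend L M j k (cusp r (Eta (N - j)) y *m G j))
    (cusp r (Eta (N - (j + k))) y *m G (j + k)).
Proof.
elim: k j => [|k IH] j jkN yT; first by rewrite addn0; exists 1; rewrite ?oner_eq0 ?scale1r.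
have jN : (j < N)%N by lia.
have [_ lnk] := linkG jN.
have [||_ step] := cremona_vec_cusp r3 lnk (y := y).
- by move=> i; apply: yT; lia.
- by move=> i; apply: yT; lia.
rewrite addnS -addSn /=; apply: proportional_trans (IH _ _ _) => //; last first.
- by move=> kappa i h; apply: yT; lia.
- by lia.
- exact: ascend_proportional.
Qed.

Lemma descend_proportional0 k w : (k <= l)%N -> path k w ->
  proportional (ascend L M (l - k) k (z k w)) (z 0 w).
Proof.
move=> kl pk; apply: (@ascend_descend _ _ _ L _ _ M w l k 0%N) => // i il.
by have [] := @linkG i (ltn_trans il lN).
Qed.

Let B0 j : (j < N)%N -> \det (level_frame L M j) != 0.
Proof. by move=> /linkG[[]]. Qed.

(** Climbing back to level l recovers the point of the line, and its two coordinates recover the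
    parameter. *)
Lemma descend_inj k w w' y : (k <= l)%N -> path k w -> path k w' ->
  proportional (z k w) y -> proportional (z k w') y -> w = w'.
Proof.
move=> kl pw pw' wy w'y.
have ww' : proportional (z k w) (z k w').
  exact: proportional_trans wy (proportional_sym w'y).
have [x x0 xE] : proportional (z 0 w) (z 0 w').
  apply: proportional_trans (proportional_sym (descend_proportional0 kl pw)) _.
  apply: proportional_trans (descend_proportional0 kl pw').
  exact: ascend_proportional.
have coordE k' v : frame_coord (level_frame L M l) (z 0 v) 0 k' =
    \det (level_frame L M l) * ((k0 == k')%:R + v * (k1 == k')%:R).
  by rewrite /z /= -[row (L l k0) _]scale1r frame_coord_line mul1r.
have eqn k' : (k0 == k')%:R + w * (k1 == k')%:R =
    x * ((k0 == k')%:R + w' * (k1 == k')%:R).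
  by apply: (mulfI (B0 lN)); rewrite -coordE xE frame_coordZ mxE coordE; ring.
have := eqn k0; rewrite eqxx [k1 == _]eq_sym (negPf k01) !mulr0 !addr0 mulr1 => x1.
by have := eqn k1; rewrite -x1 (negPf k01) eqxx !add0r !mulr1 mul1r.
Qed.

Lemma trace_descend k w : (k <= l)%N -> path k w ->
  trace L M l k2 (l - k) k (z k w) = 0.
Proof.
move=> kl pk; rewrite /trace; have [x _ ->] := descend_proportional0 kl pk.
rewrite frame_coordZ mxE /z /= -[row (L l k0) _]scale1r frame_coord_line.
by rewrite (negPf k02) (negPf k12) !mulr0 addr0 !mulr0.
Qed.

Lemma trace_proportional j k u v : proportional u v ->
  trace L M l k2 j k v = 0 -> trace L M l k2 j k u = 0.
Proof.
move=> /(ascend_proportional L M j k)[x _ uv] v0; rewrite /trace uv frame_coordZ mxE.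
by rewrite -/(trace L M l k2 j k v) v0 mulr0.
Qed.

(* If the [i]-th coordinate vanished along the whole curve, the curve would lie
   on a hyperplane section of the scroll and hence contain the residual
   intersection point of this hyperplane with the cuspidal curve; but that point
   does not come from the line we started with. *)
Lemma coordinate_nonzero k (R : {poly K}) i : (k < l)%N -> R != 0 ->
  (forall w, R.[w] != 0 -> path k w) ->
  exists2 w, R.[w] != 0 & frame_coord (level_frame L M (l - k.+1)) (z k w) 0 i != 0.
Proof.
move=> kl R0 pathR; apply: contrapT => none.
have coord0 w : R.[w] != 0 -> frame_coord (level_frame L M (l - k.+1)) (z k w) 0 i = 0.
  by move=> Rw; apply/eqP/negPn/negP => ci; apply: none; exists w.
have lnk := link_down kl; set kappa := (kappa0 + k)%N in lnk.
set B := level_frame L M (l - k.+1) in coord0 lnk.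
pose t := T kappa \o L (l - k.+1).
have SE : \sum_k t k - Eta kappa = Dr kappa by exact: S_down.
pose x0 := t i - (\sum_k t k - Eta kappa).
have mem k' : L (l - k.+1) k' \in codom (L kappa.+1).
  by rewrite L_down // codom_f.
(* The residual parameter is that of base point i after the step; parameters that move never return,
   so it is no node at any earlier time. *)
have x0E : x0 = T kappa.+1 (L (l - k.+1) i) by rewrite T_shift mem /x0 SE.
have x0_node kappa' a : (kappa' <= kappa)%N -> x0 != T kappa' a.
  move=> le; rewrite x0E; have [<-|ne] := eqVneq (L (l - k.+1) i) a.
    exact: T_moved.
  exact: T_neq.
have L_inj k' k'' : k' != k'' -> L (l - k.+1) k' != L (l - k.+1) k''.
  by apply: contraNneq => /(level_index_inj (r3 := r3)) ->.
have sigma_sum k' k'' : k' != k'' -> sigma k != t k' + t k''.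
  move=> kk; rewrite /t /T /= -rmorphD eqr_int.
  by have [] := secant_sum_neq kappa0_even (L_inj _ _ kk) (mem k') (mem k'').
have x1_node k' : k' != i -> sigma k - x0 != t k'.
  rewrite eq_sym => kk; rewrite /x0 SE /t /T /= -!rmorphB eqr_int.
  by have [] := secant_sum_neq kappa0_even (L_inj _ _ kk) (mem i) (mem k').
pose curve := section_curve B t (c (l - k) \o L (l - k.+1)) (Eta kappa) (sigma k) i.
pose last := section_end B t (c (l - k) \o L (l - k.+1)) (Eta kappa) (sigma k) i.
have [Q QE] : polynomial_fun (fun p => trace L M l k2 (l - k) k (curve p)).
  have algP := polynomial_fun_algebra K.
  apply: trace_algebra => //; apply: algebra_mulmx => //; last exact: mx_in_algebra_cst.
  move=> a b; pose numer k' := (t k' - t i) * (t k' - (sigma k - x0)) /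
    (c (l - k) (L (l - k.+1) k') * node_weight t k').
  rewrite (_ : (fun p => _) = fun p => numer b * \prod_(l | (l != i) && (l != b))
      (p + t l ^+ 2 - sigma k * t l)); last by apply: funext => p; rewrite mxE.
  apply: algebra_mul => //; first exact: algebra_cst.
  apply: algebra_prod => // m; rewrite (_ : (fun p => _) =
      fun p => p + (t m ^+ 2 - sigma k * t m)); last by apply: funext => p; rewrite addrA.
  apply: algebra_add => //; [exact: polynomial_fun_id | exact: algebra_cst].
(* At the parameter of the residual point the section curve meets the cuspidal curve. That point
   climbs to a cuspidal point of level l that is no node and so has all coordinates nonzero. *)
have Q0 : Q != 0.
  apply/eqP => Q0; have := QE (x0 * (sigma k - x0)); rewrite Q0 horner0 => /esym Z.
  have cuspE : proportional (cusp r (Eta kappa) x0 *m G (l - k)) (curve (x0 * (sigma k - x0))).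
    apply: proportional_sym; apply: (section_curve_cusp r3 lnk x1_node) => k'.
    exact: x0_node.
  have {}Z := trace_proportional cuspE Z.
  have jkl : (l - k + k = l)%N by lia.
  have [||x xx0 xE] := @ascend_cusp (l - k) k x0.
  - by lia.
  - by move=> kappa' a h; apply: x0_node; move: h; rewrite /kappa /kappa0; lia.
  rewrite time ?(ltnW kl) // -/kappa in xE.
  move: Z; rewrite /trace xE frame_coordZ mxE jkl => /eqP.
  rewrite mulf_eq0 (negPf xx0) /=; apply/negP.
  have [_ lnkl] := linkG lN.
  have [||coord _] := cremona_vec_cusp r3 lnkl (y := x0).
  - by move=> k'; apply: x0_node; rewrite /kappa /kappa0; lia.
  - by move=> k'; apply: x0_node; rewrite /kappa /kappa0; lia.
  exact: coord.
have [rs' rsP] := exists_root_seq Q0.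
have z_neq0 w : R.[w] != 0 -> z k w != 0.
  move=> Rw; apply/eqP => Z; have pw := pathR w Rw.
  have coordZ A : frame_coord A (z k w) = 0 by rewrite Z /frame_coord mul0mx.
  case: (k) kl pw coordZ => [_ _|k' k'l pw] coordZ.
    have := frame_coord_line (L l) (level L M l) k0 k1 k0 1 w.
    rewrite scale1r -[_ + _]/(z 0 w) coordZ mxE eqxx [k1 == _]eq_sym (negPf k01).
    by rewrite mulr0 addr0 !mulr1 => /esym/eqP; apply/negP/B0.
  have jN : (l - k'.+1 < N)%N by lia.
  have := cremona_vec_coord (B0 jN) (pw k' (ltnSn k')) k0.
  by rewrite -[cremona_vec _ _]/(z k'.+1 w) coordZ mxE eqxx.
(* Images of the line have trace 0, so on the section curve they can only sit at roots of [Q];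
   together with the frame points and the end this leaves finitely many places for infinitely many
   parameters. *)
pose Y := [seq row k' B | k' <- enum 'I_r.+1] ++ last :: [seq curve p | p <- rs'].
have [||ws wsP] := @finite_fibers K _ (fun w => R.[w] != 0)
    (fun w y => proportional (z k w) y) Y.
- by move=> w w' y Rw Rw'; apply: descend_inj (ltnW kl) (pathR w Rw) (pathR w' Rw').
- move=> w Rw; have pw := pathR w Rw.
  have sc := descend_scroll (ltnW kl) pw.
  have [[k' zk']|zlast|[p zp]] := hyperplane_section r3 lnk sigma_sum x1_node
    (z_neq0 w Rw) sc (coord0 w Rw).
  + by exists (row k' B) => //; rewrite mem_cat (map_f (fun k' => row k' B)) // mem_enum.
  + by exists last => //; rewrite mem_cat inE eqxx orbT.
  + exists (curve p) => //; rewrite mem_cat inE (map_f curve) ?orbT //; apply: rsP.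
    rewrite QE; apply: trace_proportional (proportional_sym zp) _.
    exact: trace_descend (ltnW kl) pw.
have P0 : R * \prod_(w <- ws) ('X - w%:P) != 0.
  by rewrite mulf_neq0 // monic_neq0 // monic_prod_XsubC.
have [w] := exists_nonroot P0; rewrite hornerM mulf_eq0 negb_or => /andP[Rw].
by rewrite -/(root _ w) root_prod_XsubC (wsP w Rw).
Qed.

(** The coordinates of the k-th image are polynomials in w, none of them zero; multiplying them into
    [R] adds the next step. *)
Lemma generic_path k : (k <= l)%N ->
  exists2 R : {poly K}, R != 0 & forall w, R.[w] != 0 -> path k w.
Proof.
elim: k => [_|k IH kl]; first by exists 1; rewrite ?oner_neq0.
have [R R0 RP] := IH (ltnW kl).
have algP := polynomial_fun_algebra K.
have /boolp.choice[p pE] : forall i, exists p : {poly K}, forall w,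
    p.[w] = frame_coord (level_frame L M (l - k.+1)) (z k w) 0 i.
  move=> i; apply: (algebra_frame_coord algP (F := fun w => z k w)).
    exact: mx_in_algebra_cst.
  apply: (algebra_descend L algP _ _ _ _ (F := fun=> M)); last exact: polynomial_fun_id.
  exact: mx_in_algebra_cst.
have p0 i : p i != 0.
  have [w _] := coordinate_nonzero i kl R0 RP.
  by rewrite -pE; apply: contra_neq => ->; rewrite horner0.
exists (R * \prod_i p i) => [|w].
  by rewrite mulf_neq0 //; apply/prodf_neq0.
rewrite hornerM mulf_eq0 negb_or horner_prod => /andP[Rw /prodf_neq0 pw] k'.
rewrite ltnS leq_eqVlt => /orP[/eqP ->|k'k] i; last exact: RP.
by rewrite -pE; exact: pw.
Qed.

Lemma exists_descent : exists2 w, w != 0 & path l w.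
Proof.
have [R R0 RP] := generic_path (leqnn l).
have [|w] := exists_nonroot (p := R * 'X); first by rewrite mulf_neq0 // polyX_eq0.
by rewrite hornerM hornerX mulf_eq0 negb_or => /andP[/RP pw w0]; exists w.
Qed.

End Path.

End CuspidalWitness.

Lemma exists_descends_below (K : numFieldType) (r s : nat) (r3 : (3 <= r)%N)
    (rs : (r + 5 <= s)%N) (m : nat) :
  exists (M : 'M[K]_(s, r.+1)) w, (forall l, w l != 0) /\
    descends_below (level_index r3 rs) ord0 (inord 1) m w M.
Proof.
(* The length 2m of the history is even and exceeds every level l < m. *)
have even2m : ~~ odd m.*2 by rewrite odd_double.
have [G [c [levelG linkG]]] := exists_cusp_levels K r3 rs even2m.
set M := \matrix_(i < s) _ in levelG linkG.
have /boolp.choice[w wP] : forall l, exists w : K, w != 0 /\ ((l < m)%N -> ~~ odd l ->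
    descends (level_index r3 rs) (level_index r3 rs l ord0)
      (level_index r3 rs l (inord 1)) M w l l).
  move=> l; have [lm|lm] := ltnP l m; last by exists 1; rewrite oner_neq0.
  have [l_odd|l_even] := boolP (odd l); first by exists 1; rewrite oner_neq0.
  have lN : (l < m.*2)%N by lia.
  by have [w w0 pw] := exists_descent even2m levelG linkG lN l_even; exists w.
exists M, w; split=> [l|]; first exact: (wP l).1.
split=> [j jm|l lm l_even]; last exact: (wP l).2.
by have [] := linkG j _; first lia.
Qed.

Local Open Scope classical_set_scope.

Theorem corollary5p14 (R : realType) (r s : nat)
    (hr : (3 <= r)%N) (hs : (r + 5 <= s)%N) :
  [/\ forall i j : 'I_s, i != j ->
        infinite_set (weyl_orbit r (line_class i j)),
      very_general (fun p : config (complex R) r s =>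
        infinite_set [set D : set (blowup p) | weyl_line D])
    & infinite_set [set c : curve_class s | numerical_m1_class r c]].
Proof.
split; first by move=> i j; exact: line_orbit_infinite.
(* Frame indices 0 and 1 span the line, and index 2 selects a coordinate hyperplane containing
   it. *)
- apply: (very_general_weyl_lines (K := complex R) (fr := level_index hr hs)
    (k0 := ord0) (k1 := inord 1) (k2 := inord 2)).
  + by move=> j; exact: level_index_inj.
  + by rewrite -val_eqE /= inordK //; lia.
  + by rewrite -val_eqE /= inordK //; lia.
  + by rewrite -val_eqE /= !inordK //; lia.
  + exact: (@exists_descends_below (complex R) r s hr hs).
- by apply: numerical_m1_infinite; lia.
Qed.
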